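(* Let $(\widetilde{\mu},\mu)$ be a pair of probability measures on $\mathbb{R}$ with all moments finite, with Jacobi parameters $\widetilde{\beta}_m,\widetilde{\gamma}_m$ and $\beta_m,\gamma_m$ respectively. (1) Assume that neither $\widetilde{\mu}$ nor $\mu$ is a point mass and that, for the conditionally free powers $(\widetilde{\mu}_t,\mu_t):=(\widetilde{\mu},\mu)^{\boxplus_c t}$, $t\in\mathbb{N}$, all Jacobi parameters of $\widetilde{\mu}_t$ are polynomials in $t$. Then $$\beta_1=\widetilde{\beta}_2=\beta_2=\widetilde{\beta}_3=\beta_3=\widetilde{\beta}_4=\cdots,\qquad \gamma_1=\widetilde{\gamma}_2=\gamma_2=\widetilde{\gamma}_3=\gamma_3=\widetilde{\gamma}_4=\cdots.$$ (2) Conversely, if these equalities hold, put $\widetilde{b}=\widetilde{\beta}_1-\beta_0$, $b=\beta_1-\beta_0$, $\widetilde{c}=\widetilde{\gamma}_1-\gamma_0$, $c=\gamma_1-\gamma_0$. Then the conditionally free power $(\widetilde{\mu}_t,\mu_t)=(\widetilde{\mu},\mu)^{\boxplus_c t}$ exists for $t\ge0$ with $c+\gamma_0t\ge0$ and $\widetilde{c}+\gamma_0t\ge0$, and $$J(\widetilde{\mu}_t)=\begin{pmatrix}\widetilde{\beta}_0t,&\widetilde{b}+\beta_0t,& b+\beta_0t,& b+\beta_0t,&\dots\\ \widetilde{\gamma}_0t,&\widetilde{c}+\gamma_0t,& c+\gamma_0t,& c+\gamma_0t,&\dots\end{pmatrix},\qquad J(\mu_t)=\begin{pmatrix}\beta_0t,&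 b+\beta_0t,& b+\beta_0t,&\dots\\ \gamma_0t,& c+\gamma_0t,& c+\gamma_0t,&\dots\end{pmatrix}.$$ In particular, the pair $(\widetilde{\mu},\mu)$ is $\boxplus_c$-infinitely divisible if and only if $c\ge0$ and $\widetilde{c}\ge0$. In this case $$R^{\widetilde{\mu},\mu}(z)=\widetilde{\beta}_0z+\widetilde{\gamma}_0z^2\int_{\mathbb{R}}\frac{d\widetilde{\rho}(x)}{1-xz},$$ where $\widetilde{\rho}$ is the (free Meixner) probability measure with $$J(\widetilde{\rho})=\begin{pmatrix}\widetilde{b},& b,& b,& b,&\dots\\ \widetilde{c},& c,& c,& c,&\dots\end{pmatrix}.$$
   Context: Jacobi parameters: for a probability measure $\nu$ on $\mathbb{R}$ with finite moments, the monic orthogonal polynomials satisfy $xP_m=P_{m+1}+\beta_mP_m+\gamma_{m-1}P_{m-1}$ ($P_0=1$, $P_{-1}=0$), and $J(\nu)$ is the two-row array $(\beta_m;\gamma_m)$; if $\nu$ has finite support, parameters after the first vanishing $\gamma$ are undefined and disregarded. $\nu$ is a point mass iff $\gamma_0(\nu)=0$. For a noncrossing partition $\pi$ of $\{1,\dots,m\}$ (set $NC(m)$), a block $U$ is inner if there is another block $W$ and $a,b\in W$ with $a<u<b$ for all $u\in U$, and outer otherwise. Free cumulants $r_n(\mu)$: $s_m(\mu)=\int x^md\mu=\sum_{\pi\in NC(m)}\prod_{V\in\pi}r_{|V|}(\mu)$; free convolution power $\mu^{\boxplus t}$ is the measure (if it exists) with $r_n(\mu^{\boxplus t})=t\,r_n(\mu)$.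 Two-state (conditionally) free cumulants $R_n(\widetilde{\mu},\mu)$: $s_m(\widetilde{\mu})=\sum_{\pi\in NC(m)}\prod_{U\text{ outer}}R_{|U|}(\widetilde{\mu},\mu)\prod_{U\text{ inner}}r_{|U|}(\mu)$. The conditionally free power $(\widetilde{\mu},\mu)^{\boxplus_c t}=(\widetilde{\mu}_t,\mu_t)$ is the pair of probability measures (if it exists) with $\mu_t=\mu^{\boxplus t}$ and $R_n(\widetilde{\mu}_t,\mu_t)=t\,R_n(\widetilde{\mu},\mu)$ for all $n$; the pair is $\boxplus_c$-infinitely divisible if this power exists for all $t\ge0$. $R^{\widetilde{\mu},\mu}(z)=\sum_{k\ge1}R_k(\widetilde{\mu},\mu)z^k$ as a formal power series. *)

(* Defs.v *)
From HB Require Import structures.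
From mathcomp Require Import all_boot all_order all_algebra.
From mathcomp Require Import all_classical all_reals all_analysis.

Set Implicit Arguments.
Unset Strict Implicit.
Unset Printing Implicit Defensive.

Import Order.TTheory GRing.Theory Num.Theory.

Local Open Scope ring_scope.

(* classical_sets shadows finset.partition and finset.setT. *)

Definition noncrossing (m : nat) (pi : {set {set 'I_m}}) : bool :=
  [forall V in pi, forall W in pi, (V != W) ==>
    ~~ [exists a in V, exists b in W, exists c in V, exists d in W,
          [&& (a < b)%N, (b < c)%N & (c < d)%N]]].

Definition NC (m : nat) : {set {set {set 'I_m}}} :=
  [set pi | finset.partition pi (finset.setTfor 'I_m) && noncrossing pi]%SET.

Definition inner (m : nat) (pi : {set {set 'I_m}}) (U : {set 'I_m}) : bool :=
  [exists W in pi, (W != U) &&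
    [exists a in W, exists b in W,
      [forall u in U, (a < u)%N && (u < b)%N]]].

Definition outer (m : nat) (pi : {set {set 'I_m}}) (U : {set 'I_m}) : bool :=
  ~~ inner pi U.

Section Measures.
Context {R : realType}.

Definition prob_on_line := probability (measurableTypeR R) R.

Implicit Types (mu nu rho : prob_on_line) (r Rc beta gamma : nat -> R).

Definition finite_moments mu : Prop :=
  forall k : nat, mu.-integrable setT (fun x : measurableTypeR R => (x ^+ k)%:E).

Definition moment mu (k : nat) : R :=
  Rintegral mu setT (fun x : measurableTypeR R => x ^+ k).

Definition point_mass mu : Prop :=
  exists a : measurableTypeR R,
    forall A : set (measurableTypeR R), measurable A -> mu A = \d_a A.

(* If the support of mu has exactly N points, then P N vanishes mu-almost
   everywhere; the conditions below force gamma (N - 1) = 0, all P m with N <= m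
   are multiples of P N, and beta m and gamma m are arbitrary for N <= m.  So
   the entries after the first vanishing gamma are disregarded, and all other
   entries are determined by mu. *)
Definition is_jacobi mu beta gamma : Prop :=
  exists P : nat -> {poly R},
    [/\ P 0%N = 1,
        'X * P 0%N = P 1%N + beta 0%N *: P 0%N,
        forall m : nat, 'X * P m.+1 =
          P m.+2 + beta m.+1 *: P m.+1 + gamma m *: P m
      & forall i j : nat, i != j ->
          Rintegral mu setT
            (fun x : measurableTypeR R => (P i).[x] * (P j).[x]) = 0].

Definition jacobi_defined gamma (m : nat) : Prop :=
  forall k : nat, (k < m)%N -> gamma k != 0.

(* beta 1 = betat 2 = beta 2 = betat 3 = ... and likewise for gamma, where
   undefined entries are skipped. *)
Definition jacobi_coincide betat gammat beta gamma : Prop :=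
  forall m : nat, (0 < m)%N ->
    (jacobi_defined gamma m -> beta m = beta 1%N /\ gamma m = gamma 1%N) /\
    (jacobi_defined gammat m.+1 ->
      betat m.+1 = beta 1%N /\ gammat m.+1 = gamma 1%N).

(* Cumulants are indexed by block sizes, so their value at 0 is irrelevant. *)
Definition is_free_cumulants mu r : Prop :=
  forall m : nat, moment mu m = \sum_(pi in NC m) \prod_(V in pi) r #|V|.

(* r stands for the free cumulants of the second measure of the pair. *)
Definition is_cfree_cumulants mut r Rc : Prop :=
  forall m : nat, moment mut m =
    \sum_(pi in NC m)
      (\prod_(U in pi | outer pi U) Rc #|U|) *
      (\prod_(U in pi | inner pi U) r #|U|).

Definition is_free_power mu (t : R) mu_t : Prop :=
  finite_moments mu_t /\
  exists r, is_free_cumulants mu r /\ is_free_cumulants mu_t (fun n => t * r n).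

Definition is_cfree_power mut mu (t : R) mut_t mu_t : Prop :=
  [/\ is_free_power mu t mu_t,
      finite_moments mut_t
    & exists r r_t Rc,
        [/\ is_free_cumulants mu r, is_free_cumulants mu_t r_t,
            is_cfree_cumulants mut r Rc
          & is_cfree_cumulants mut_t r_t (fun n => t * Rc n)]].

Definition cfree_infdiv mut mu : Prop :=
  forall t : R, 0 <= t -> exists mut_t mu_t, is_cfree_power mut mu t mut_t mu_t.

(* A formal power series in z is given by its sequence of coefficients. *)
Definition fps := nat -> R.

Definition fps_mulXn (n : nat) (f : fps) : fps :=
  fun k => if (k < n)%N then 0 else f (k - n)%N.

Definition fps_C (a : R) : fps := fun k => if k == 0%N then a else 0.

(* 1 / (1 - x z) *)
Definition fps_geom (x : R) : fps := fun k => x ^+ k.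

Lemma fps_geomP (x : R) (k : nat) :
  fps_geom x k - x * fps_mulXn 1 (fps_geom x) k = fps_C 1 k.
Proof.
rewrite /fps_geom /fps_mulXn /fps_C; case: k => [|k] /=.
  by rewrite mulr0 subr0 expr0.
by rewrite subn1 /= -exprS subrr.
Qed.

Definition fps_integral rho (f : R -> fps) : fps :=
  fun k => Rintegral rho setT (fun x : measurableTypeR R => f x k).

Definition cfree_R_transform Rc : fps :=
  fun k => if k == 0%N then 0 else Rc k.

(* The sequences (a, b, b, ...) and (a, b, c, c, ...). *)
Definition row2 (a b : R) : nat -> R := fun m => if m is 0%N then a else b.

Definition row3 (a b c : R) : nat -> R :=
  fun m => match m with 0%N => a | 1%N => b | _ => c end.

End Measures.

Arguments prob_on_line : clear implicits.

(* Main.v *)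
(* A block of a noncrossing partition is read off from its last point backwards;
   cutting it at the predecessor of that point turns the moment-cumulant formulas
   into M = 1 + z M T(z M) and Mt = 1 + z Mt TR(z M), where M and Mt are the moment
   series of mu and mut, and T and TR are the shifted cumulant series.

   (2) Stripping the first Jacobi parameters from the two Meixner families gives
   the series M sigma(z M) and M rho(z M), where sigma and rho do not depend on t.
   Hence T = beta0 + gamma0 z sigma(z) and TR = betat0 + gammat0 z rho(z) are the
   same for all t, so that the powers have the announced parameters.  Measures
   with these parameters exist by Favard's theorem: truncated Jacobi matrices
   provide discrete measures, whose quantile functions converge along an
   ultrafilter.

   (1) Suppose that the cumulants agree with those of the Meixner family up to
   some order.  At the next order the moments of the stripped mut_t differ from
   those of the Meixner family by an affine function of t.  In terms of the
   Jacobi parameters this difference is gammat_1(t) ... gammat_m(t) times the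
   difference of the next parameter, and every factor gammat_i(t) has degree 1.
   So both sides vanish as soon as m >= 2, and also for m = 1 because the
   cumulants of mu of order at most 4 are adjusted by beta_1 and gamma_1. *)

(* Everything is reduced to identities of formal power series. A measure enters only through its
   moments: by [is_jacobi_jmom], having given Jacobi parameters means having the moments
   [jmom beta gamma]. This series ignores all parameters after a vanishing [gamma], which settles
   the convention for finite support. Cumulants become series linked to the moments by [cfree_eq];
   they are unique, so the cumulants chosen separately for each power in [is_cfree_power] belong to
   one and the same pair of series. All uniqueness statements rest on one principle: a factor [pX]
   raises the order up to which two series agree, so an equation whose unknown occurs only behind
   [pX] has at most one solution. To identify a series it is enough to check that it satisfies such
   an equation. The sign conditions come from squared norms: the product of the first [m] parameters
   [gamma] is the squared norm of the monic orthogonal polynomial of degree [m]. *)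
Require Import Defs.
From HB Require Import structures.
From mathcomp Require Import all_boot all_order all_algebra.
From mathcomp Require Import zify ring lra.

Set Implicit Arguments.
Unset Strict Implicit.
Unset Printing Implicit Defensive.

Import Order.TTheory GRing.Theory Num.Theory.

Local Open Scope ring_scope.

(** * Noncrossing partitions *)

(* [lia] is very slow in contexts with many non-arithmetic hypotheses. *)
Ltac ord_lia :=
  repeat match goal with H : ?T |- _ =>
    lazymatch type of T with Prop =>
      lazymatch T with
      | is_true (leq _ _) => fail
      | @eq nat _ _ => fail
      | _ => clear H
      end
    end
  end; lia.

Section NoncrossingPartitions.
Variable N : nat.
Implicit Types (D U V W : {set 'I_N}) (pi : {set {set 'I_N}}) (x p u : 'I_N).

Definition ncpart D pi := partition pi D && noncrossing pi.

(** Pointwise form of [ncpart]. The set [D] is arbitrary because cutting a partition leaves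
    partitions of subsets of the same ['I_N]. *)
Record ncpart_spec D pi : Prop := NcpartSpec {
  ncp_sub : forall U u, U \in pi -> u \in U -> u \in D;
  ncp_cov : forall u, u \in D -> exists2 U, U \in pi & u \in U;
  ncp_disj : forall U W u, U \in pi -> W \in pi -> u \in U -> u \in W -> U = W;
  ncp_ne : forall U, U \in pi -> exists u, u \in U;
  ncp_nc : forall U W (a b c d : 'I_N), U \in pi -> W \in pi ->
    a \in U -> b \in W -> c \in U -> d \in W ->
    (a < b)%N -> (b < c)%N -> (c < d)%N -> U = W }.

Lemma ncpartP D pi : reflect (ncpart_spec D pi) (ncpart D pi).
Proof.
apply: (iffP andP) => [[pD /forallP nc]|[H1 H2 H3 H4 H5]].
  have tI := partition_trivIset pD.
  split.
  - by move=> U u Upi; apply/subsetP/(partitionS pD).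
  - move=> u; rewrite -(cover_partition pD) => uc.
    by exists (pblock pi u); rewrite ?pblock_mem ?mem_pblock.
  - move=> U W u Upi Wpi uU uW.
    by rewrite -(def_pblock tI Upi uU) (def_pblock tI Wpi uW).
  - by move=> U /(partition_neq0 pD)/set0Pn.
  - move=> U W a b c d Upi Wpi aU bW cU dW ab bc cd.
    apply/eqP/negPn/negP => UW.
    have /implyP/(_ Upi)/forallP/(_ W)/implyP/(_ Wpi)/implyP/(_ UW)/negP := nc U.
    apply; apply/existsP; exists a; rewrite aU /=.
    apply/existsP; exists b; rewrite bW /=.
    apply/existsP; exists c; rewrite cU /=.
    by apply/existsP; exists d; rewrite dW ab bc cd.
split.
  apply/and3P; split.
  - apply/eqP/setP => u; apply/bigcupP/idP.
      by case=> U; apply: H1.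
    by move=> /H2[U]; exists U.
  - apply/trivIsetP => U W Upi Wpi UW; apply/pred0P => u /=.
    by apply: contra_neqF UW => /andP[]; apply: H3.
  - by apply/negP => /H4[u]; rewrite inE.
apply/forallP => U; apply/implyP => Upi.
apply/forallP => W; apply/implyP => Wpi.
apply/implyP; apply: contra_neqN.
move=> /existsP[a /andP[aU]] /existsP[b /andP[bW]] /existsP[c /andP[cU]].
by move=> /existsP[d /andP[dW /and3P[]]]; apply: H5.
Qed.

Lemma ncp_pblock D pi U u : ncpart_spec D pi -> U \in pi -> u \in U -> pblock pi u = U.
Proof.
by move=> /ncpartP/andP[/partition_trivIset tI _]; apply: def_pblock.
Qed.

Lemma ncp_pblock_mem D pi u : ncpart_spec D pi -> u \in D ->
  pblock pi u \in pi /\ u \in pblock pi u.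
Proof. by move=> H /(ncp_cov H)[U Upi uU]; rewrite (ncp_pblock H Upi uU). Qed.

Lemma innerP pi U : reflect
  (exists W a b, [/\ W \in pi, W != U, a \in W, b \in W &
     forall u, u \in U -> (a < u)%N && (u < b)%N]) (inner pi U).
Proof.
apply: (iffP existsP) => [[W /and3P[Wpi WU]]|[W [a [b [Wpi WU aW bW H]]]]].
  move=> /existsP[a /andP[aW /existsP[b /andP[bW /forallP H]]]].
  by exists W, a, b; split=> // u uU; move: (H u); rewrite uU.
exists W; rewrite Wpi WU /=; apply/existsP; exists a; rewrite aW /=.
apply/existsP; exists b; rewrite bW /=; apply/forallP => u; apply/implyP.
exact: H.
Qed.

(* The block of the greatest point [x] is cut at the predecessor [p] of [x] in
   that block: what lies below [p] keeps its nesting, what lies between [p] and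
   [x] becomes inner. *)
Definition glue x p (y : {set {set 'I_N}} * {set {set 'I_N}}) : {set {set 'I_N}} :=
  (x |: pblock y.1 p) |: (y.1 :\ pblock y.1 p) :|: y.2.

Definition split_at x p pi : {set {set 'I_N}} * {set {set 'I_N}} :=
  ((pblock pi x :\ x) |: [set U in pi | (x \notin U) && [forall u in U, (u <= p)%N]],
   [set U in pi | (x \notin U) && [forall u in U, (p < u)%N]]).

Definition is_pred x p pi :=
  [&& p \in pblock pi x, p != x & [forall q in pblock pi x, (q <= p)%N || (q == x)]].

Definition below D p := [set q in D | (q <= p)%N].
Definition above D p := [set q in D | (p < q)%N].

Lemma glueP x p pi1 pi2 U : reflect
  [\/ U = x |: pblock pi1 p, U \in pi1 /\ U != pblock pi1 p | U \in pi2]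
  (U \in glue x p (pi1, pi2)).
Proof.
rewrite /glue !inE -orbA /=; apply: (iffP or3P) => -[H|H|H].
- by constructor 1; apply/eqP.
- by constructor 2; case/andP: H => -> ->.
- by constructor 3.
- by constructor 1; apply/eqP.
- by constructor 2; case: H => -> ->.
- by constructor 3.
Qed.

(** The critical crossing is [a < b < c < d] with [b], [d] in the enlarged block and [a], [c] in
    another block of [pi1]. There [c < p], since [p] lies in the enlarged block, and [p] can replace
    [d], which gives a crossing inside [pi1]. Blocks of [pi1] and of [pi2] are separated by [p]. *)
Lemma ncp_glue D x p pi1 pi2 : (forall y, y \in D -> (y < x)%N) -> p \in D ->
  ncpart_spec (below D p) pi1 -> ncpart_spec (above D p) pi2 ->
  ncpart_spec (x |: D) (glue x p (pi1, pi2)).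
Proof.
move=> Dx pD H1 H2.
have pB : p \in below D p by rewrite inE pD /=.
have [V1pi pV1] := ncp_pblock_mem H1 pB.
set V1 := pblock pi1 p in V1pi pV1.
have S1 U u : U \in pi1 -> u \in U -> (u \in D) /\ (u <= p)%N.
  by move=> /(ncp_sub H1) H /H; rewrite inE => /andP.
have S2 U u : U \in pi2 -> u \in U -> (u \in D) /\ (p < u)%N.
  by move=> /(ncp_sub H2) H /H; rewrite inE => /andP.
have px := Dx _ pD.
have X1 U : U \in pi1 -> x \notin U.
  by move=> Upi; apply/negP => /(S1 _ _ Upi)[/Dx]; rewrite ltnn.
have X2 U : U \in pi2 -> x \notin U.
  by move=> Upi; apply/negP => /(S2 _ _ Upi)[/Dx]; rewrite ltnn.
split.
- move=> U u /glueP[->|[Upi _]|Upi] /=.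
  + rewrite !inE => /orP[->//|/(S1 _ _ V1pi)[-> _]]; by rewrite orbT.
  + by move=> /(S1 _ _ Upi)[uD _]; rewrite !inE uD orbT.
  + by move=> /(S2 _ _ Upi)[uD _]; rewrite !inE uD orbT.
- move=> u /setU1P[->|uD].
    by exists (x |: V1); [apply/glueP; constructor 1|rewrite !inE eqxx].
  case: (leqP u p) => up.
    have [|U Upi uU] := ncp_cov H1 (u := u); first by rewrite inE uD.
    case: (eqVneq U V1) => [UV|UV].
      exists (x |: V1); first by apply/glueP; constructor 1.
      by rewrite inE -UV uU orbT.
    by exists U => //; apply/glueP; constructor 2.
  have [|U Upi uU] := ncp_cov H2 (u := u); first by rewrite inE uD.
  by exists U => //; apply/glueP; constructor 3.
- have disj12 U W u : U \in pi1 -> W \in pi2 -> u \in U -> u \in W -> False.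
    by move=> /S1 h1 /S2 h2 /h1[_ ?] /h2[_]; ord_lia.
  move=> U W u /glueP[->|[Upi UV]|Upi] /glueP[->|[Wpi WV]|Wpi] //= uU uW.
  + have xu : u != x by apply: contraNneq (X1 _ Wpi) => <-.
    move: uU; rewrite !inE (negPf xu) /= => uU.
    by rewrite (ncp_disj H1 Wpi V1pi uW uU) eqxx in WV.
  + have xu : u != x by apply: contraNneq (X2 _ Wpi) => <-.
    move: uU; rewrite !inE (negPf xu) /= => uU.
    by case: (disj12 _ _ _ V1pi Wpi uU uW).
  + have xu : u != x by apply: contraNneq (X1 _ Upi) => <-.
    move: uW; rewrite !inE (negPf xu) /= => uW.
    by rewrite (ncp_disj H1 Upi V1pi uU uW) eqxx in UV.
  + exact (ncp_disj H1 Upi Wpi uU uW).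
  + by case: (disj12 _ _ _ Upi Wpi uU uW).
  + have xu : u != x by apply: contraNneq (X2 _ Upi) => <-.
    move: uW; rewrite !inE (negPf xu) /= => uW.
    by case: (disj12 _ _ _ V1pi Upi uW uU).
  + by case: (disj12 _ _ _ Wpi Upi uW uU).
  + exact (ncp_disj H2 Upi Wpi uU uW).
- move=> U /glueP[->|[Upi _]|Upi]; last 2 first.
  + exact (ncp_ne H1 Upi).
  + exact (ncp_ne H2 Upi).
  + by exists x; rewrite !inE eqxx.
- move=> U W a b c d gU gW aU bW cU dW ab bc cd.
  have le_x T y : T \in glue x p (pi1, pi2) -> y \in T -> (y <= x)%N.
    move=> /glueP[->|[/S1 h _]|/S2 h] //=.
    + by rewrite inE => /orP[/set1P->//|/(S1 _ _ V1pi)[/Dx/ltnW]].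
    + by move=> /h[/Dx/ltnW].
    + by move=> /h[/Dx/ltnW].
  have dx := le_x _ _ gW dW.
  have nx (y : 'I_N) : (y < x)%N -> (y == x) = false by move=> yx; apply/negbTE; rewrite neq_ltn yx.
  have [ax bx cx] : [/\ (a < x)%N, (b < x)%N & (c < x)%N] by split; ord_lia.
  case/glueP: (gU) => [UE|[Upi UV]|Upi]; case/glueP: (gW) => [WE|[Wpi WV]|Wpi] /=.
  + by rewrite UE WE.
  + have dNx : (d == x) = false by apply: contraNF (X1 _ Wpi) => /eqP<-.
    move: aU cU; rewrite UE !inE !nx //= => aU cU.
    by move: WV; rewrite -(ncp_nc H1 V1pi Wpi aU bW cU dW ab bc cd) /V1 /= eqxx.
  + move: aU cU; rewrite UE !inE !nx //= => /(S1 _ _ V1pi)[_ ap] /(S1 _ _ V1pi)[_ cp].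
    by have [_] := S2 _ _ Wpi bW; ord_lia.
  + move: bW dW; rewrite WE !inE nx //= => bV dV.
    have cp : (c <= p)%N by have [] := S1 _ _ Upi cU.
    case: (eqVneq c p) => [cE|cNp].
      move: UV; rewrite /= (ncp_disj H1 Upi V1pi cU) ?eqxx //.
      by rewrite cE.
    have cp' : (c < p)%N by rewrite ltn_neqAle cp cNp.
    by move: UV; rewrite /= (ncp_nc H1 Upi V1pi aU bV cU pV1 ab bc cp') eqxx.
  + exact (ncp_nc H1 Upi Wpi aU bW cU dW ab bc cd).
  + by have [_] := S1 _ _ Upi cU; have [_] := S2 _ _ Wpi bW; ord_lia.
  + move: bW; rewrite WE !inE nx //= => /(S1 _ _ V1pi)[_].
    by have [_] := S2 _ _ Upi aU; ord_lia.
  + by have [_] := S2 _ _ Upi aU; have [_] := S1 _ _ Wpi bW; ord_lia.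
  + exact (ncp_nc H2 Upi Wpi aU bW cU dW ab bc cd).
Qed.

Section Split.
Variables (D : {set 'I_N}) (x p : 'I_N) (pi : {set {set 'I_N}}).
Hypotheses (Dx : forall y, y \in D -> (y < x)%N) (pD : p \in D).
Hypotheses (H : ncpart_spec (x |: D) pi) (predp : is_pred x p pi).

Let V := pblock pi x.

Let Vpi : V \in pi /\ x \in V.
Proof. by apply: ncp_pblock_mem H _; rewrite !inE eqxx. Qed.

Let pV : p \in V. Proof. by case/and3P: predp. Qed.

Let px : (p < x)%N. Proof. exact: Dx. Qed.

Let V_le q : q \in V -> q != x -> (q <= p)%N.
Proof.
case/and3P: predp => _ _ /forallP/(_ q)/implyP h /h /orP[//|->//].
Qed.

Let in_D U u : U \in pi -> u \in U -> u != x -> u \in D.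
Proof. by move=> Upi /(ncp_sub H Upi); rewrite !inE => /orP[->|]. Qed.

(** Otherwise [u < p < v < x] would be a crossing with the block of [x], which contains [p]. *)
Lemma block_side U u v : U \in pi -> x \notin U -> u \in U -> v \in U ->
  (u <= p)%N -> (v <= p)%N.
Proof.
case: Vpi => VP xV Upi xU uU vU up; rewrite leqNgt; apply/negP => pv.
have UV : U != V by apply: contraNneq xU => ->.
have uNp : (u < p)%N.
  rewrite ltn_neqAle up andbT; apply: contraNneq UV => up'.
  by apply/eqP; apply: (ncp_disj H Upi VP (u := p)) => //; rewrite -(val_inj up').
have vx : (v < x)%N.
  by apply: Dx; apply: (in_D Upi vU); apply: contraNneq xU => <-.
by move: UV; rewrite (ncp_nc H Upi VP uU pV vU xV uNp pv vx) eqxx.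
Qed.

Lemma split1P U : reflect
  (U = V :\ x \/ [/\ U \in pi, x \notin U & forall u, u \in U -> (u <= p)%N])
  (U \in (split_at x p pi).1).
Proof.
rewrite !inE; apply: (iffP orP) => -[].
- by move/eqP; left.
- by case/and3P => Upi xU /forallP h; right; split=> // u uU; move: (h u); rewrite uU.
- by move->; left.
- case=> Upi xU h; right; rewrite Upi xU /=; apply/forallP => u; apply/implyP.
  exact: h.
Qed.

Lemma split2P U : reflect
  [/\ U \in pi, x \notin U & forall u, u \in U -> (p < u)%N]
  (U \in (split_at x p pi).2).
Proof.
rewrite !inE; apply: (iffP and3P) => -[Upi xU h]; split=> //.
  by move=> u uU; move/forallP/(_ u): h; rewrite uU.
by apply/forallP => u; apply/implyP; apply: h.
Qed.

Lemma ncp_split1 : ncpart_spec (below D p) (split_at x p pi).1.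
Proof.
case: Vpi => VP xV; split.
- move=> U u /split1P[->|[Upi xU h]].
    by rewrite !inE => /andP[ux uV]; rewrite (in_D VP uV ux) V_le.
  move=> uU; rewrite inE h // andbT; apply: (in_D Upi uU).
  by apply: contraNneq xU => <-.
- move=> u; rewrite inE => /andP[uD up].
  have [|U Upi uU] := ncp_cov H (u := u); first by rewrite !inE uD orbT.
  have ux : u != x by rewrite neq_ltn Dx.
  case: (boolP (x \in U)) => xU.
    exists (V :\ x); first by apply/split1P; left.
    by rewrite !inE ux /= /V (ncp_pblock H Upi xU).
  exists U => //; apply/split1P; right; split=> // v vU.
  exact: block_side Upi xU uU vU up.
- move=> U W u /split1P[->|[Upi xU h]] /split1P[->|[Wpi xW k]] //.
  + rewrite !inE => /andP[ux uV] uW.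
    by move: xW; rewrite -(ncp_disj H VP Wpi uV uW) xV.
  + rewrite !inE => uU /andP[ux uV].
    by move: xU; rewrite -(ncp_disj H VP Upi uV uU) xV.
  + by move=> uU uW; apply: (ncp_disj H Upi Wpi uU uW).
- move=> U /split1P[->|[Upi xU h]]; last exact (ncp_ne H Upi).
  by exists p; rewrite !inE pV andbT neq_ltn px.
- move=> U W a b c d.
  move=> /split1P[->|[Upi xU h]] /split1P[->|[Wpi xW k]] //.
  + rewrite !inE => /andP[_ aV] bW /andP[_ cV] dW ab bc cd.
    by move: xW; rewrite -(ncp_nc H VP Wpi aV bW cV dW ab bc cd) xV.
  + rewrite !inE => aU /andP[_ bV] cU /andP[_ dV] ab bc cd.
    by move: xU; rewrite (ncp_nc H Upi VP aU bV cU dV ab bc cd) xV.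
  + by move=> aU bW cU dW ab bc cd; apply: (ncp_nc H Upi Wpi aU bW cU dW).
Qed.

Lemma ncp_split2 : ncpart_spec (above D p) (split_at x p pi).2.
Proof.
split.
- move=> U u /split2P[Upi xU h] uU; rewrite inE h // andbT.
  by apply: (in_D Upi uU); apply: contraNneq xU => <-.
- move=> u; rewrite inE => /andP[uD up].
  have [|U Upi uU] := ncp_cov H (u := u); first by rewrite !inE uD orbT.
  have ux : u != x by rewrite neq_ltn Dx.
  have xU : x \notin U.
    apply/negP => xU; move: up; rewrite ltnNge V_le //.
    by rewrite /V (ncp_pblock H Upi xU).
  exists U => //; apply/split2P; split=> // v vU.
  rewrite ltnNge; apply/negP => vp.
  by move: up; rewrite ltnNge (block_side Upi xU vU uU vp).
- move=> U W u /split2P[Upi _ _] /split2P[Wpi _ _] uU uW.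
  exact (ncp_disj H Upi Wpi uU uW).
- by move=> U /split2P[Upi _ _]; exact (ncp_ne H Upi).
- move=> U W a b c d /split2P[Upi _ _] /split2P[Wpi _ _] aU bW cU dW ab bc cd.
  exact (ncp_nc H Upi Wpi aU bW cU dW ab bc cd).
Qed.

Lemma split_pblock : pblock (split_at x p pi).1 p = V :\ x.
Proof.
apply: (ncp_pblock ncp_split1); first by apply/split1P; left.
by rewrite !inE pV andbT neq_ltn px.
Qed.

Lemma glue_split : glue x p (split_at x p pi) = pi.
Proof.
case: Vpi => VP xV.
have VE : x |: (V :\ x) = V by rewrite setD1K.
apply/setP => U; rewrite [split_at x p pi]surjective_pairing.
apply/glueP/idP; rewrite split_pblock.
  case=> [->|[/split1P[->|[//]] /eqP//]|/split2P[//]].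
  by rewrite VE.
move=> Upi; case: (boolP (x \in U)) => xU.
  by constructor 1; rewrite VE /V (ncp_pblock H Upi xU).
have [u uU] := ncp_ne H Upi.
case: (leqP u p) => up.
  constructor 2; split.
    apply/split1P; right; split=> // v vU.
    exact: block_side Upi xU uU vU up.
  apply: contraNneq xU => UV; have uV : u \in V by move: uU; rewrite UV !inE => /andP[].
  by rewrite -(ncp_disj H VP Upi uV uU).
constructor 3; apply/split2P; split=> // v vU.
rewrite ltnNge; apply/negP => vp.
by move: up; rewrite ltnNge (block_side Upi xU vU uU vp).
Qed.

End Split.

Section Glue.
Variables (D : {set 'I_N}) (x p : 'I_N) (pi1 pi2 : {set {set 'I_N}}).
Hypotheses (Dx : forall y, y \in D -> (y < x)%N) (pD : p \in D).
Hypotheses (H1 : ncpart_spec (below D p) pi1) (H2 : ncpart_spec (above D p) pi2).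

Let H := ncp_glue Dx pD H1 H2.
Let V := pblock pi1 p.

Lemma glue_block : V \in pi1 /\ p \in V.
Proof. by apply: ncp_pblock_mem H1 _; rewrite inE pD /=. Qed.

Lemma glue_notin1 U : U \in pi1 -> x \notin U.
Proof.
move=> Upi; apply/negP => /(ncp_sub H1 Upi).
by rewrite inE => /andP[/Dx]; rewrite ltnn.
Qed.

Lemma glue_notin2 U : U \in pi2 -> x \notin U.
Proof.
move=> Upi; apply/negP => /(ncp_sub H2 Upi).
by rewrite inE => /andP[/Dx]; rewrite ltnn.
Qed.

Lemma pblock_glue : pblock (glue x p (pi1, pi2)) x = x |: V.
Proof.
apply: (ncp_pblock H); last by rewrite !inE eqxx.
by apply/glueP; constructor 1.
Qed.

Lemma is_pred_glue : is_pred x p (glue x p (pi1, pi2)).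
Proof.
have [Vpi pV] := glue_block.
rewrite /is_pred pblock_glue !inE pV orbT /= neq_ltn Dx //=.
apply/forallP => q; apply/implyP; rewrite !inE => /orP[->|]; first by rewrite orbT.
by move/(ncp_sub H1 Vpi); rewrite inE => /andP[_ ->].
Qed.

Lemma split_glue : split_at x p (glue x p (pi1, pi2)) = (pi1, pi2).
Proof.
have [Vpi pV] := glue_block.
rewrite [LHS]surjective_pairing; congr pair; apply/setP => U.
  apply/split1P/idP; rewrite pblock_glue setU1K ?(glue_notin1 Vpi) //.
    case=> [->//|[/glueP[->|[//]|Upi2]]].
      by rewrite !inE eqxx.
    have [u uU] := ncp_ne H2 Upi2 => _ /(_ _ uU).
    by have := ncp_sub H2 Upi2 uU; rewrite inE ltnNge => /andP[_ /negPf->].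
  move=> Upi; case: (eqVneq U V) => [->|UV]; first by left.
  right; split; [by apply/glueP; constructor 2|exact: glue_notin1|].
  by move=> u /(ncp_sub H1 Upi); rewrite inE => /andP[].
apply/split2P/idP; last first.
  move=> Upi; split; [by apply/glueP; constructor 3|exact: glue_notin2|].
  by move=> u /(ncp_sub H2 Upi); rewrite inE => /andP[].
case=> /glueP[->|[Upi1 _]|//]; first by rewrite !inE eqxx.
have [u uU] := ncp_ne H1 Upi1 => _ /(_ _ uU).
by have := ncp_sub H1 Upi1 uU; rewrite inE ltnNge => /andP[_ ->].
Qed.

(** If the enlarged block encloses [U], then [V] already does, with [p] as right end: the points of
    [U] are at most [p], and [p] is not among them. *)
Lemma inner_glue1 U : U \in pi1 -> U != V ->
  inner (glue x p (pi1, pi2)) U = inner pi1 U.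
Proof.
have [Vpi pV] := glue_block.
move=> Upi UV; apply/innerP/innerP => -[W [a [b [Wpi WU aW bW h]]]].
  have lep u : u \in U -> (u <= p)%N.
    by move/(ncp_sub H1 Upi); rewrite inE => /andP[].
  have [u0 u0U] := ncp_ne H1 Upi.
  case/glueP: Wpi => [WE|[Wpi WV]|Wpi].
  - exists V, a, p; split=> //.
    + by rewrite eq_sym.
    + move: aW; rewrite WE !inE => /orP[/eqP ax|//].
      have /andP[au _] := h _ u0U; have := lep _ u0U; have := Dx pD.
      by rewrite ax in au *; ord_lia.
    + move=> u uU; have /andP[-> _] := h _ uU.
      rewrite ltn_neqAle lep //= andbT; apply: contraNneq UV => up.
      by rewrite (ncp_disj H1 Upi Vpi (u := u)) // (val_inj up).
  - by exists W, a, b.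
  - have /andP[au _] := h _ u0U; have := lep _ u0U.
    have := ncp_sub H2 Wpi aW; rewrite inE => /andP[_]; ord_lia.
case: (eqVneq W V) => [WE|WV].
  exists (x |: V), a, b; split=> //.
  - by apply/glueP; constructor 1.
  - by apply: contraNneq (glue_notin1 Upi) => <-; rewrite !inE eqxx.
  - by rewrite -WE !inE aW orbT.
  - by rewrite -WE !inE bW orbT.
by exists W, a, b; split=> //; apply/glueP; constructor 2.
Qed.

(** Enclosed between [p] and [x], which lie in one block. *)
Lemma inner_glue2 U : U \in pi2 -> inner (glue x p (pi1, pi2)) U.
Proof.
have [Vpi pV] := glue_block.
move=> Upi; apply/innerP; exists (x |: V), p, x; split.
- by apply/glueP; constructor 1.
- by apply: contraNneq (glue_notin2 Upi) => <-; rewrite !inE eqxx.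
- by rewrite !inE pV orbT.
- by rewrite !inE eqxx.
- by move=> u /(ncp_sub H2 Upi); rewrite inE => /andP[/Dx-> ->].
Qed.

End Glue.

Section Singleton.
Variables (D : {set 'I_N}) (x : 'I_N) (pi : {set {set 'I_N}}).
Hypothesis Dx : forall y, y \in D -> (y < x)%N.

Let xND : x \notin D.
Proof. by apply/negP => /Dx; rewrite ltnn. Qed.

Lemma ncp_notin U : ncpart_spec D pi -> U \in pi -> x \notin U.
Proof. by move=> H Upi; apply: contraNN xND; apply: (ncp_sub H Upi). Qed.

Lemma ncp_add1 : ncpart_spec D pi -> ncpart_spec (x |: D) ([set x] |: pi).
Proof.
move=> H; have nx := ncp_notin H; split.
- move=> U u; rewrite !inE => /orP[/eqP->|Upi].
    by rewrite inE => ->.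
  by move=> uU; rewrite (ncp_sub H Upi uU) orbT.
- move=> u; rewrite !inE => /orP[/eqP->|/(ncp_cov H)[U Upi uU]].
    by exists [set x]; rewrite !inE eqxx.
  by exists U => //; rewrite !inE Upi orbT.
- move=> U W u; rewrite !inE => /orP[/eqP->|Upi] /orP[/eqP->|Wpi] //.
  + by rewrite inE => /eqP->; rewrite (negPf (nx _ Wpi)).
  + by rewrite inE => uU /eqP ux; move: uU; rewrite ux (negPf (nx _ Upi)).
  + by apply: (ncp_disj H Upi Wpi).
- move=> U; rewrite !inE => /orP[/eqP->|Upi]; last exact (ncp_ne H Upi).
  by exists x; rewrite inE.
- move=> U W a b c d; rewrite !inE => /orP[/eqP->|Upi] /orP[/eqP->|Wpi] //.
  + by rewrite !inE => /eqP-> bW /eqP-> dW; ord_lia.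
  + by rewrite !inE => aU /eqP-> cU /eqP->; ord_lia.
  + by apply: (ncp_nc H Upi Wpi).
Qed.

Lemma ncp_rem1 : ncpart_spec (x |: D) pi -> [set x] \in pi ->
  ncpart_spec D (pi :\ [set x]).
Proof.
move=> H xpi; split.
- move=> U u; rewrite !inE => /andP[Ux Upi] uU.
  have := ncp_sub H Upi uU; rewrite !inE => /orP[/eqP ux|//].
  by move: Ux; rewrite (ncp_disj H Upi xpi uU) ?eqxx // ux inE.
- move=> u uD; have [|U Upi uU] := ncp_cov H (u := u); first by rewrite !inE uD orbT.
  exists U => //; rewrite !inE Upi andbT; apply: contraNneq xND => Ux.
  by move: uU; rewrite Ux inE => /eqP<-.
- move=> U W u; rewrite !inE => /andP[_ Upi] /andP[_ Wpi].
  exact: (ncp_disj H Upi Wpi).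
- by move=> U; rewrite !inE => /andP[_ Upi]; exact (ncp_ne H Upi).
- move=> U W a b c d; rewrite !inE => /andP[_ Upi] /andP[_ Wpi].
  exact: (ncp_nc H Upi Wpi).
Qed.

Lemma inner_add1 U : ncpart_spec D pi -> U \in pi ->
  inner ([set x] |: pi) U = inner pi U.
Proof.
move=> H Upi; apply/innerP/innerP => -[W [a [b [Wpi WU aW bW h]]]]; last first.
  by exists W, a, b; rewrite !inE Wpi orbT.
move: Wpi; rewrite !inE => /orP[/eqP WE|Wpi]; last by exists W, a, b.
have [u uU] := ncp_ne H Upi; move: aW bW (h _ uU).
by rewrite WE !inE => /eqP-> /eqP->; ord_lia.
Qed.

End Singleton.

Section Weights.
Variables (K : comNzRingType) (r Rc : nat -> K).

Definition nc_sum D := \sum_(pi | ncpart D pi) \prod_(U in pi) r #|U|.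

Definition wt pi U := if inner pi U then r #|U| else Rc #|U|.

Definition cfree_sum D := \sum_(pi | ncpart D pi) \prod_(U in pi) wt pi U.

(* [j] counts the points that were already cut off from the block of [x]. *)
Definition wt_at j x pi U := if x \in U then Rc (#|U| + j)%N else wt pi U.

Definition marked_sum j x D :=
  \sum_(pi | ncpart D pi) \prod_(U in pi) wt_at j x pi U.

Lemma sum_singleton j x D : (forall y, y \in D -> (y < x)%N) ->
  \sum_(pi | ncpart (x |: D) pi && ([set x] \in pi)) \prod_(U in pi) wt_at j x pi U =
  Rc j.+1 * cfree_sum D.
Proof.
move=> Dx.
rewrite (reindex_onto (fun pi => [set x] |: pi) (fun pi => pi :\ [set x])) /=; last first.
  by move=> pi /andP[_ xpi]; rewrite setD1K.
rewrite /cfree_sum big_distrr /=; apply: eq_big => [pi|pi].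
  rewrite setU11 andbT; apply/andP/idP => [[/ncpartP H /eqP E]|/ncpartP H].
    by apply/ncpartP; rewrite -E; apply: ncp_rem1 => //; rewrite setU11.
  split; first exact/ncpartP/ncp_add1.
  rewrite setU1K //; apply/negP => /(ncp_notin Dx H).
  by rewrite inE eqxx.
move=> /andP[/andP[/ncpartP H' _] /eqP E].
have H : ncpart_spec D pi by rewrite -E; apply: ncp_rem1 => //; rewrite setU11.
have xpi : [set x] \notin pi.
  by apply/negP => /(ncp_notin Dx H); rewrite inE eqxx.
rewrite big_setU1 //= {1}/wt_at inE eqxx cards1 add1n; congr (_ * _).
apply: eq_bigr => U Upi; rewrite /wt_at (negPf (ncp_notin Dx H Upi)) /wt.
by rewrite (inner_add1 (D := D)).
Qed.

(** The block of [x] has one point more than what the cut leaves of it, so the counter moves to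
    [j.+1] and the weight is unchanged. The blocks above [p] are all inner, whatever their nesting
    among themselves, hence the factor [nc_sum]. *)
Lemma sum_pred j x p D : (forall y, y \in D -> (y < x)%N) -> p \in D ->
  \sum_(pi | ncpart (x |: D) pi && is_pred x p pi) \prod_(U in pi) wt_at j x pi U =
  marked_sum j.+1 p (below D p) * nc_sum (above D p).
Proof.
move=> Dx pD.
rewrite (reindex_onto (glue x p) (split_at x p)) /=; last first.
  by move=> pi /andP[/ncpartP H predp]; apply: glue_split H predp.
rewrite /marked_sum /nc_sum big_distrlr /= pair_big /=.
apply: eq_big => [[pi1 pi2]|[pi1 pi2]] /=.
  apply/andP/andP => [[/andP[/ncpartP H predp] /eqP E]|[/ncpartP H1 /ncpartP H2]].
    move: (ncp_split1 Dx pD H predp) (ncp_split2 Dx H predp).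
    by rewrite E /= => H1 H2; split; apply/ncpartP.
  split; last by rewrite (split_glue Dx pD H1 H2).
  rewrite (is_pred_glue Dx pD H1 H2) andbT; apply/ncpartP.
  exact: ncp_glue.
move=> /andP[/andP[/ncpartP H predp] /eqP E].
have {E}[H1 H2] : ncpart_spec (below D p) pi1 /\ ncpart_spec (above D p) pi2.
  move: (ncp_split1 Dx pD H predp) (ncp_split2 Dx H predp).
  by rewrite E.
have [Vpi pV] := glue_block pD H1.
set V := pblock pi1 p in Vpi pV.
have disj : [disjoint (x |: V) |: (pi1 :\ V) & pi2].
  apply/pred0P => U /=; apply/negP; rewrite !inE => /andP[/orP[/eqP->|/andP[_ Upi]] Upi2].
    by move: (glue_notin2 Dx H2 Upi2); rewrite !inE eqxx.
  have [u uU] := ncp_ne H1 Upi.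
  have := ncp_sub H1 Upi uU; have := ncp_sub H2 Upi2 uU; rewrite !inE.
  by case/andP => _ ? /andP[_]; ord_lia.
rewrite /glue /= -/V -/(glue x p (pi1, pi2)).
have -> : \prod_(U in (x |: V) |: (pi1 :\ V) :|: pi2) wt_at j x (glue x p (pi1, pi2)) U =
   (\prod_(U in (x |: V) |: (pi1 :\ V)) wt_at j x (glue x p (pi1, pi2)) U) *
   \prod_(U in pi2) wt_at j x (glue x p (pi1, pi2)) U.
  by rewrite -bigU //; apply: eq_bigl => U; rewrite !inE.
congr (_ * _); last first.
  apply: eq_bigr => U Upi.
  by rewrite /wt_at (negPf (glue_notin2 Dx H2 Upi)) /wt (inner_glue2 Dx pD H1 H2).
rewrite big_setU1 /=; last first.
  rewrite !inE negb_and negbK; apply/orP; right; apply/negP => /(glue_notin1 Dx H1).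
  by rewrite !inE eqxx.
rewrite [RHS](big_setD1 V) //=; congr (_ * _).
  by rewrite /wt_at !inE eqxx /= pV cardsU1 (glue_notin1 Dx H1) //= add1n addSnnS.
apply: eq_bigr => U; rewrite !inE => /andP[UV Upi].
rewrite /wt_at (negPf (glue_notin1 Dx H1 Upi)) ifF; last first.
  apply: contraNF UV => pU; apply/eqP.
  exact: (ncp_disj H1 Upi Vpi pU pV).
by rewrite /wt (inner_glue1 Dx pD H1 H2).
Qed.

(** Either [x] forms a singleton block, or the partitions are sorted by the predecessor of [x] in
    its block. *)
Lemma marked_sum_rec j x D : (forall y, y \in D -> (y < x)%N) ->
  marked_sum j x (x |: D) = Rc j.+1 * cfree_sum D +
    \sum_(p in D) marked_sum j.+1 p (below D p) * nc_sum (above D p).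
Proof.
move=> Dx; rewrite -(sum_singleton j Dx).
under [X in _ + X]eq_bigr => p pD do rewrite -(sum_pred j Dx pD).
rewrite /marked_sum (bigID (fun pi => [set x] \in pi)) /=; congr (_ + _).
(* [kap pi] is the predecessor of [x]; the default value is not reached as long as [[set x]] is not
   a block. *)
pose kap pi : 'I_N := odflt x [pick p | is_pred x p pi].
have xNis pi : is_pred x x pi = false by rewrite /is_pred eqxx andbF.
have uniq_pred pi p q : is_pred x p pi -> is_pred x q pi -> p = q.
  move=> /and3P[pV px /forallP hp] /and3P[qV qx /forallP hq].
  apply/val_inj/eqP; rewrite eqn_leq.
  by move: (hp q) (hq p); rewrite pV qV /= (negPf px) (negPf qx) !orbF => -> ->.
have spec pi : ncpart_spec (x |: D) pi -> [set x] \notin pi ->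
    kap pi \in D /\ is_pred x (kap pi) pi.
  move=> H xpi; rewrite /kap; case: pickP => [p pp|none] /=.
    split=> //; case/and3P: pp => pV px _.
    have [VP xV] := ncp_pblock_mem H (setU11 x D).
    by have := ncp_sub H VP pV; rewrite !inE (negPf px).
  have [VP xV] := ncp_pblock_mem H (setU11 x D).
  set V := pblock pi x in VP xV.
  have [q] : exists q, q \in V :\ x.
    apply/set0Pn; apply: contraNneq xpi => V0.
    suff -> : [set x] = V by [].
    by rewrite -(setD1K xV) V0 setU0.
  move=> qV; case: (@arg_maxnP _ q (fun q => q \in V :\ x) val qV) => p pV hp.
  have := none p; rewrite /is_pred; move: pV; rewrite !inE => /andP[-> pV].
  rewrite /= -/V pV /= => /negP[]; apply/forallP => u; apply/implyP => uV.
  case: (eqVneq u x) => ux; rewrite ?orbT ?orbF //.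
  by apply: hp; rewrite !inE ux.
rewrite (partition_big kap (mem D)) /=; last first.
  by move=> pi /andP[/ncpartP H xpi]; case: (spec _ H xpi).
apply: eq_bigr => p pD; apply: eq_bigl => pi.
apply/andP/andP => [[/andP[/ncpartP H xpi] /eqP <-]|[/ncpartP H pp]].
  by split; [apply/ncpartP|case: (spec _ H xpi)].
split; last first.
  rewrite /kap; case: pickP => [q qp|/(_ p)] /=; last by rewrite pp.
  by rewrite (uniq_pred _ _ _ pp qp).
apply/andP; split; first by apply/ncpartP.
apply/negP => xpi; case/and3P: pp.
rewrite (ncp_pblock H xpi (set11 x)) inE => /eqP px.
by rewrite px eqxx.
Qed.

(** The block of the greatest point cannot be enclosed, so it is outer and has a weight [Rc]
    anyway. *)
Lemma marked_sum0 x D : x \in D -> (forall y, y \in D -> (y <= x)%N) ->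
  marked_sum 0%N x D = cfree_sum D.
Proof.
move=> xD Dx; apply: eq_bigr => pi /ncpartP H; apply: eq_bigr => U Upi.
rewrite /wt_at /wt; case: ifP => // xU; rewrite addn0 ifF //.
apply/negbTE/negP => /innerP in_U; case: in_U => W [a [b [Wpi WU aW bW h]]]; have := h _ xU.
by have := Dx _ (ncp_sub H Wpi bW); ord_lia.
Qed.

Lemma sum_ncpart0 (F : {set {set 'I_N}} -> {set 'I_N} -> K) :
  \sum_(pi | ncpart finset.set0 pi) \prod_(U in pi) F pi U = 1.
Proof.
have e (pi : {set {set 'I_N}}) : ncpart finset.set0 pi = (pi == finset.set0).
  apply/ncpartP/eqP => [H|->].
    apply/setP => U; rewrite [in RHS]inE; apply/negP => Upi.
    have [u uU] := ncp_ne H Upi.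
    by have := ncp_sub H Upi uU; rewrite inE.
  by split=> [U u|u|U W u|U|U W a b c d]; rewrite inE.
rewrite (eq_bigl _ _ e) big_pred1_eq big1 // => U; by rewrite inE.
Qed.

End Weights.
End NoncrossingPartitions.

(** * Moment recursions on intervals of points *)

Section Intervals.
Variables (K : comNzRingType) (r : nat -> K).

Definition itv N a b : {set 'I_N} := [set i : 'I_N | (a <= i < b)%N].

Lemma nc_sum_cfree N (D : {set 'I_N}) : nc_sum r D = cfree_sum r r D.
Proof.
by apply: eq_bigr => pi _; apply: eq_bigr => U _; rewrite /wt if_same.
Qed.

Lemma itvS N a n (h : (a + n < N)%N) : itv N a (a + n).+1 = Ordinal h |: itv N a (a + n).
Proof. by apply/setP => i; rewrite !inE -val_eqE /=; ord_lia. Qed.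

Lemma marked_itv_rec (Rc : nat -> K) N a n j (h : (a + n < N)%N) :
  marked_sum r Rc j (Ordinal h) (itv N a (a + n).+1) =
    Rc j.+1 * cfree_sum r Rc (itv N a (a + n)) +
    \sum_(i < n) marked_sum r Rc j.+1 (Ordinal (leq_ltn_trans (leq_add (leqnn a) (ltnW (ltn_ord i))) h))
                   (itv N a (a + i).+1) * nc_sum r (itv N (a + i.+1) (a + n)).
Proof.
rewrite itvS marked_sum_rec; last by move=> y; rewrite inE => /andP[].
congr (_ + _).
pose g (i : 'I_n) := Ordinal (leq_ltn_trans (leq_add (leqnn a) (ltnW (ltn_ord i))) h).
have gi : injective g by move=> i k [] /addnI ?; apply: val_inj.
have -> : itv N a (a + n) = [set g i | i : 'I_n].
  apply/setP => p; rewrite inE; apply/idP/imsetP => [/andP[ap pn]|[i _ ->]] /=.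
    have pan : (p - a < n)%N by ord_lia.
    by exists (Ordinal pan) => //; apply: val_inj => /=; ord_lia.
  by have := ltn_ord i; ord_lia.
rewrite big_imset /=; last by move=> ? ? _ _ /gi.
apply: eq_bigr => i _; have ? := ltn_ord i.
congr (_ * _); [congr (marked_sum _ _ _ _)|congr nc_sum]; apply/setP => q; rewrite !inE.
  apply/andP/idP => [[/imsetP[k _ ->] /=]|/=]; have := ltn_ord q; first by ord_lia.
  move=> _ /andP[aq qi]; split; last by ord_lia.
  have qan : (q - a < n)%N by ord_lia.
  by apply/imsetP; exists (Ordinal qan) => //; apply: val_inj => /=; ord_lia.
apply/andP/idP => [[/imsetP[k _ ->] /=]|/=]; first by have := ltn_ord k; ord_lia.
move=> /andP[aq qi]; split; last by ord_lia.
have qan : (q - a < n)%N by ord_lia.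
by apply/imsetP; exists (Ordinal qan) => //; apply: val_inj => /=; ord_lia.
Qed.

Definition cfree_seq Rc n := cfree_sum r Rc (itv n 0%N n).

(** Here [n] counts the points before the marked one, so that [n.+1] points are partitioned. The
    form [0 + n] matches the left end [a = 0] in [itv_shift]. *)
Definition marked_seq Rc j n := marked_sum r Rc j (@Ordinal n.+1 (0 + n) (ltnSn n)) (itv n.+1 0%N (0 + n).+1).

Lemma cfree_itvS (Rc : nat -> K) N a n (h : (a + n < N)%N) :
  cfree_sum r Rc (itv N a (a + n).+1) =
  marked_sum r Rc 0%N (Ordinal h) (itv N a (a + n).+1).
Proof.
by rewrite marked_sum0 // => [|y]; rewrite inE /= ?leqnn ?leq_addr // ltnS => /andP[].
Qed.

(** The sums depend only on the number of points. Both claims are proved together: the plain sum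
    over [n] points is the marked sum over the same points, and the recursion for marked sums calls
    plain and marked sums over shorter intervals with other left ends. *)
Lemma itv_shift n :
  (forall Rc N a, (a + n <= N)%N -> cfree_sum r Rc (itv N a (a + n)) = cfree_seq Rc n) /\
  (forall Rc j N a (h : (a + n < N)%N),
     marked_sum r Rc j (Ordinal h) (itv N a (a + n).+1) = marked_seq Rc j n).
Proof.
elim/ltn_ind: n => n IH.
have Pn Rc N a : (a + n <= N)%N -> cfree_sum r Rc (itv N a (a + n)) = cfree_seq Rc n.
  case: n IH => [|n] IH h.
    rewrite /cfree_seq /cfree_sum addn0.
    have -> : itv N a a = finset.set0 by apply/setP => i; rewrite !inE; ord_lia.
    have -> : itv 0%N 0%N 0%N = finset.set0 by apply/setP => i; rewrite !inE; ord_lia.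
    by rewrite !sum_ncpart0.
  rewrite addnS in h *; rewrite (cfree_itvS Rc h) (IH n (leqnn _)).2.
  symmetry; exact: (@cfree_itvS Rc n.+1 0%N n (ltnSn n)).
split=> // Rc j N a h.
rewrite /marked_seq !marked_itv_rec Pn ?(ltnW h) // Pn //; congr (_ + _).
apply: eq_bigr => i _; have ? := ltn_ord i.
rewrite (IH i _).2 // (IH i _).2 //; congr (_ * _).
rewrite !nc_sum_cfree.
have e b : (b + n = b + i.+1 + (n - i.+1))%N by ord_lia.
by rewrite (e a) (e 0%N) !(IH _ _).1 //; ord_lia.
Qed.

Lemma cfree_seq0 Rc : cfree_seq Rc 0%N = 1.
Proof.
rewrite /cfree_seq /cfree_sum.
have -> : itv 0%N 0%N 0%N = finset.set0 by apply/setP => i; rewrite !inE; ord_lia.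
exact: sum_ncpart0.
Qed.

Lemma cfree_seqS Rc n : cfree_seq Rc n.+1 = marked_seq Rc 0%N n.
Proof. exact: (@cfree_itvS Rc n.+1 0%N n (ltnSn n)). Qed.

Lemma marked_seq_rec Rc j n : marked_seq Rc j n = Rc j.+1 * cfree_seq Rc n +
  \sum_(i < n) marked_seq Rc j.+1 i * cfree_seq r (n - i.+1).
Proof.
rewrite [LHS]marked_itv_rec (itv_shift n).1 ?add0n //; congr (_ + _).
apply: eq_bigr => i _; have ? := ltn_ord i.
rewrite (itv_shift i).2 //; congr (_ * _).
rewrite nc_sum_cfree.
have -> : (0 + n = 0 + i.+1 + (n - i.+1))%N by ord_lia.
by rewrite (itv_shift _).1 //; ord_lia.
Qed.

Lemma cfree_seqE Rc m : cfree_seq Rc m =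
  \sum_(pi in NC m) (\prod_(U in pi | outer pi U) Rc #|U|) *
                    (\prod_(U in pi | inner pi U) r #|U|).
Proof.
have -> : cfree_seq Rc m = cfree_sum r Rc (finset.setTfor 'I_m).
  by congr cfree_sum; apply/setP => i; rewrite !inE ltn_ord.
apply: eq_big => [pi|pi _]; first by rewrite !inE.
rewrite [LHS](bigID (outer pi)) /=; congr (_ * _).
  by apply: eq_bigr => U /andP[_ /negPf oU]; rewrite /wt oU.
apply: eq_big => [U|U /andP[_]]; first by rewrite /outer negbK.
by rewrite /outer negbK /wt => ->.
Qed.

Lemma nc_seqE m : cfree_seq r m = \sum_(pi in NC m) \prod_(V in pi) r #|V|.
Proof.
have -> : cfree_seq r m = cfree_sum r r (finset.setTfor 'I_m).
  by congr cfree_sum; apply/setP => i; rewrite !inE ltn_ord.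
by rewrite -nc_sum_cfree; apply: eq_bigl => pi; rewrite inE.
Qed.

End Intervals.

(** * Formal power series *)

(* Not imported before this point, because classical_sets shadows finset. *)
From mathcomp Require Import all_classical all_reals all_analysis.

(* A copy of [nat -> K], whose pointwise product is already canonical. *)
Definition pser (K : Type) := nat -> K.

HB.instance Definition _ (K : Type) := gen_eqMixin (pser K).
HB.instance Definition _ (K : Type) := gen_choiceMixin (pser K).

Section PowerSeries.
Variable K : comNzRingType.
Implicit Types (f g h w v : pser K) (a : K) (p q : {poly K}).

Lemma pserP f g : (forall n, f n = g n) -> f = g. Proof. exact: funext. Qed.

Definition pC a : pser K := fun n => if n is 0%N then a else 0.
Definition pser_add f g : pser K := fun n => f n + g n.
Definition pser_opp f : pser K := fun n => - f n.
Definition pser_mul f g : pser K := fun n => \sum_(i < n.+1) f i * g (n - i)%N.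

Fact pser_addA : associative pser_add.
Proof. by move=> f g h; apply: pserP => n; rewrite /pser_add addrA. Qed.
Fact pser_addC : commutative pser_add.
Proof. by move=> f g; apply: pserP => n; rewrite /pser_add addrC. Qed.
Fact pser_add0 : left_id (pC 0) pser_add.
Proof. by move=> f; apply: pserP => -[|n]; rewrite /pser_add add0r. Qed.
Fact pser_addN : left_inverse (pC 0) pser_opp pser_add.
Proof. by move=> f; apply: pserP => -[|n]; rewrite /pser_add addNr. Qed.

HB.instance Definition _ := GRing.isZmodule.Build (pser K)
  pser_addA pser_addC pser_add0 pser_addN.

(** Each coefficient of a product is that of a product of truncations, so the ring axioms are
    inherited from polynomials. *)
Definition trunc n f : {poly K} := \poly_(i < n) f i.

Lemma coef_trunc n f i : (i < n)%N -> (trunc n f)`_i = f i.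
Proof. by move=> h; rewrite coef_poly h. Qed.

Lemma coef_truncM n f g i : (i < n)%N -> (trunc n f * trunc n g)`_i = pser_mul f g i.
Proof.
move=> h; rewrite coefM; apply: eq_bigr => k _.
by rewrite !coef_trunc //; have := ltn_ord k; lia.
Qed.

Fact pser_mulA : associative pser_mul.
Proof.
move=> f g h; apply: pserP => n.
transitivity ((trunc n.+1 f * (trunc n.+1 g * trunc n.+1 h))`_n).
  rewrite coefM; apply: eq_bigr => i _; have ? := ltn_ord i.
  by rewrite coef_trunc // coef_truncM //; lia.
rewrite mulrA coefM; apply: eq_bigr => i _; have ? := ltn_ord i.
by rewrite coef_truncM // coef_trunc //; lia.
Qed.

Fact pser_mulC : commutative pser_mul.
Proof.
move=> f g; apply: pserP => n.
by rewrite -!(coef_truncM _ _ (ltnSn n)) mulrC.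
Qed.

Fact pser_mul1 : left_id (pC 1) pser_mul.
Proof.
move=> f; apply: pserP => n.
by rewrite /pser_mul big_ord_recl big1 ?addr0 ?mul1r ?subn0 // => i _; rewrite mul0r.
Qed.

Fact pser_mulDl : left_distributive pser_mul pser_add.
Proof.
move=> f g h; apply: pserP => n; rewrite /pser_mul /pser_add -big_split /=.
by apply: eq_bigr => i _; rewrite mulrDl.
Qed.

Fact pser_one_neq0 : pC 1 != 0.
Proof. by apply/eqP => /(congr1 (fun f => f 0%N)) /eqP; rewrite /= oner_eq0. Qed.

HB.instance Definition _ := GRing.Zmodule_isComNzRing.Build (pser K)
  pser_mulA pser_mulC pser_mul1 pser_mulDl pser_one_neq0.

Definition pX : pser K := fun n => (n == 1%N)%:R.

Lemma pserD f g n : (f + g) n = f n + g n. Proof. by []. Qed.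
Lemma pserN f n : (- f) n = - f n. Proof. by []. Qed.
Lemma pserB f g n : (f - g) n = f n - g n. Proof. by []. Qed.
Lemma pser0E n : (0 : pser K) n = 0. Proof. by case: n. Qed.
Lemma pser1E n : (1 : pser K) n = (n == 0%N)%:R. Proof. by case: n. Qed.
Lemma pserM f g n : (f * g) n = \sum_(i < n.+1) f i * g (n - i)%N. Proof. by []. Qed.

Lemma pserM0 f g : (f * g) 0%N = f 0%N * g 0%N.
Proof. by rewrite pserM big_ord_recl big_ord0 addr0 subn0. Qed.

Lemma pserCM a f n : (pC a * f) n = a * f n.
Proof. by rewrite pserM big_ord_recl big1 ?addr0 ?subn0 // => i _; rewrite mul0r. Qed.

Lemma pserXM f n : (pX * f) n = if n is n'.+1 then f n' else 0.
Proof.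
rewrite pserM; case: n => [|n]; first by rewrite big_ord_recl big_ord0 /pX mul0r addr0.
rewrite big_ord_recl big_ord_recl big1 ?addr0 /pX ?mul0r ?add0r ?mul1r /=.
  by rewrite subSS subn0.
by move=> i _; rewrite mul0r.
Qed.

Fact pC_is_zmod_morphism : zmod_morphism pC.
Proof. by move=> a b; apply: pserP => -[|n] //; rewrite pserB /= subrr. Qed.
Fact pC_is_monoid_morphism : monoid_morphism pC.
Proof.
split=> // a b; apply: pserP => n; rewrite pserCM.
by case: n => [|n] //=; rewrite mulr0.
Qed.

HB.instance Definition _ := GRing.isZmodMorphism.Build K (pser K) pC pC_is_zmod_morphism.
HB.instance Definition _ := GRing.isMonoidMorphism.Build K (pser K) pC pC_is_monoid_morphism.

Definition pshift f : pser K := fun n => f n.+1.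

Lemma pshiftK f : f = pC (f 0%N) + pX * pshift f.
Proof.
by apply: pserP => -[|n]; rewrite pserD pserXM ?addr0 ?add0r.
Qed.

Lemma pXI f g : pX * f = pX * g -> f = g.
Proof.
by move=> e; apply: pserP => n; move/(congr1 (fun h => h n.+1)): e; rewrite !pserXM.
Qed.

(** Congruence modulo [X^m], used as closeness in the [X]-adic metric. *)
Definition agree m f g := forall n, (n < m)%N -> f n = g n.

Lemma agree_refl m f : agree m f f. Proof. by []. Qed.

Lemma agreeP f g : (forall m, agree m f g) -> f = g.
Proof. by move=> h; apply: pserP => n; apply: (h n.+1). Qed.

Lemma agreeW m n f g : (m <= n)%N -> agree n f g -> agree m f g.
Proof. by move=> mn h k km; apply: h; apply: leq_trans mn. Qed.

Lemma agreeS m f g : agree m f g -> f m = g m -> agree m.+1 f g.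
Proof. by move=> h e n; rewrite ltnS leq_eqVlt => /orP[/eqP->|/h]. Qed.

Lemma agreeD m f f' g g' : agree m f f' -> agree m g g' -> agree m (f + g) (f' + g').
Proof. by move=> h k n nm; rewrite !pserD h ?k. Qed.

Lemma agreeM m f f' g g' : agree m f f' -> agree m g g' -> agree m (f * g) (f' * g').
Proof.
move=> h k n nm; rewrite !pserM; apply: eq_bigr => i _.
by have := ltn_ord i => ?; rewrite h ?k //; lia.
Qed.

Lemma agreeX m f g : agree m f g -> agree m.+1 (pX * f) (pX * g).
Proof. by move=> h [|n] nm; rewrite !pserXM // h. Qed.

Lemma agreeE m f g n : agree m f g -> agree m (f ^+ n) (g ^+ n).
Proof. by move=> h; elim: n => [|n IH] //; rewrite !exprS; apply: agreeM. Qed.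

(** Product rule at the first order at which the factors may differ: all terms but the two extreme
    ones coincide. *)
Lemma topM m f f' g g' : agree m.+1 f f' -> agree m.+1 g g' ->
  (f * g) m.+1 - (f' * g') m.+1 = f 0%N * (g m.+1 - g' m.+1) + (f m.+1 - f' m.+1) * g 0%N.
Proof.
move=> h k; rewrite !pserM big_ord_recl big_ord_recr /=.
rewrite [X in _ - X]big_ord_recl [X in _ - (_ + X)]big_ord_recr /= !subn0 /bump /= !add1n subnn.
under [X in _ - (_ + (X + _))]eq_bigr => i _.
  have ? := ltn_ord i; rewrite -h -?k; [over|by lia|by lia].
rewrite -(h 0%N) // -(k 0%N) //; ring.
Qed.

(* Composition is meaningful when the inner series has no constant term. *)
Definition ps_comp f w : pser K := fun n => \sum_(k < n.+1) f k * (w ^+ k) n.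

Lemma pserX_low w k n : w 0%N = 0 -> (n < k)%N -> (w ^+ k) n = 0.
Proof.
move=> w0; elim: k n => [//|k IH] n nk; rewrite exprS pserM big1 // => i _.
case: (eqVneq (i : nat) 0%N) => [->|i0]; first by rewrite w0 mul0r.
by rewrite IH ?mulr0 //; have := ltn_ord i; lia.
Qed.

Lemma pserX_diag w k : w 0%N = 0 -> (w ^+ k) k = w 1%N ^+ k.
Proof.
move=> w0; elim: k => [//|k IH]; rewrite !exprS pserM big_ord_recl w0 mul0r add0r.
rewrite big_ord_recl /bump /= ?add1n ?addn0 subSS subn0 IH big1 ?addr0 // => i _.
by rewrite pserX_low ?mulr0 // /bump /=; have := ltn_ord i; lia.
Qed.

(** Polynomials can be evaluated at a series directly; multiplicativity of [ps_comp] follows from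
    that of evaluation, applied to truncations. *)
Definition peval w p : pser K := (map_poly pC p).[w].

Lemma pevalE w p n m : w 0%N = 0 -> (n < m)%N ->
  peval w p n = \sum_(k < m) p`_k * (w ^+ k) n.
Proof.
move=> w0 nm; rewrite /peval.
rewrite (@horner_coef_wide _ (maxn m (size p))); last first.
  by rewrite (leq_trans (size_poly _ _)) ?leq_maxr.
rewrite -(big_mkord xpredT (fun k => (map_poly pC p)`_k * w ^+ k)) /=.
have -> : (\sum_(0 <= k < maxn m (size p)) (map_poly pC p)`_k * w ^+ k : pser K) n =
  \sum_(0 <= k < maxn m (size p)) p`_k * (w ^+ k) n.
  elim/big_ind2: _ => [|f a g b <- <-|i _]; rewrite ?pser0E //.
  by rewrite coef_map pserCM.
rewrite (big_cat_nat (n := m)) ?leq_maxl //= [X in _ + X]big_nat_cond [X in _ + X]big1 ?addr0 ?big_mkord //.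
by move=> k /andP[/andP[mk _] _]; rewrite pserX_low ?mulr0 //; lia.
Qed.

Lemma ps_comp_eval f w n m : w 0%N = 0 -> (n < m)%N -> ps_comp f w n = peval w (trunc m f) n.
Proof.
move=> w0 nm; rewrite (pevalE _ w0 (ltnSn n)); apply: eq_bigr => k _.
by rewrite coef_trunc //; have := ltn_ord k; lia.
Qed.

Lemma ps_compD f g w : ps_comp (f + g) w = ps_comp f w + ps_comp g w.
Proof.
apply: pserP => n; rewrite pserD /ps_comp -big_split /=.
by apply: eq_bigr => k _; rewrite mulrDl.
Qed.

Lemma ps_compM f g w : w 0%N = 0 -> ps_comp (f * g) w = ps_comp f w * ps_comp g w.
Proof.
move=> w0; apply: pserP => n; rewrite (ps_comp_eval _ w0 (ltnSn n)).
have -> : (ps_comp f w * ps_comp g w) n =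
    (peval w (trunc n.+1 f) * peval w (trunc n.+1 g)) n.
  by apply: (@agreeM n.+1) => // k kn; apply: ps_comp_eval.
rewrite /peval -hornerM -rmorphM /= -!/(peval w _).
rewrite !(pevalE _ w0 (ltnSn n)); apply: eq_bigr => k _.
by have ? := ltn_ord k; rewrite coef_truncM ?coef_trunc.
Qed.

Lemma ps_compC a w : ps_comp (pC a) w = pC a.
Proof.
apply: pserP => n; rewrite /ps_comp big_ord_recl big1 ?addr0 => [|k _]; last by rewrite mul0r.
by rewrite expr0 pser1E; case: n => [|n] /=; rewrite ?mulr1 ?mulr0.
Qed.

Lemma ps_compX w : w 0%N = 0 -> ps_comp pX w = w.
Proof.
move=> w0; apply: pserP => -[|n]; rewrite /ps_comp.
  by rewrite big_ord_recl big_ord0 w0 /pX mul0r addr0.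
rewrite big_ord_recl big_ord_recl big1 ?addr0 /pX /= ?mul0r ?add0r ?mul1r ?expr1 //.
by move=> i _; rewrite mul0r.
Qed.

Lemma ps_comp_shift f w : w 0%N = 0 -> ps_comp f w = pC (f 0%N) + w * ps_comp (pshift f) w.
Proof.
by move=> w0; rewrite {1}(pshiftK f) ps_compD ps_compC ps_compM // ps_compX.
Qed.

Lemma agree_comp m f f' w w' : agree m f f' -> agree m w w' ->
  agree m (ps_comp f w) (ps_comp f' w').
Proof.
move=> h k n nm; apply: eq_bigr => i _; have ? := ltn_ord i.
by rewrite h ?(agreeE _ k) //; lia.
Qed.

(** As [w] begins with [X], the coefficient of order [m] contains [f m] with factor 1 and otherwise
    only lower coefficients of [f]. *)
Lemma topcomp m f f' w w' : w 0%N = 0 -> w 1%N = 1 -> agree m f f' -> agree m.+1 w w' ->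
  ps_comp f w m - ps_comp f' w' m = f m - f' m.
Proof.
move=> w0 w1 h k; rewrite /ps_comp !big_ord_recr /=.
have -> : \sum_(i < m) f i * (w ^+ i) m = \sum_(i < m) f' i * (w' ^+ i) m.
  by apply: eq_bigr => i _; rewrite h // (agreeE _ k).
rewrite -(agreeE m k (ltnSn m)) pserX_diag // w1 expr1n; ring.
Qed.

End PowerSeries.

Arguments pX {K}.

(** * The moment-cumulant relation as an equation of power series *)

Section CumulantSeries.
Variables (K : comNzRingType).
Implicit Types (r Rc : pser K).

(** The series [F j] of marked sums and [st * ps_comp (T j) w], where [T j] is the [j]-fold shift of
    the cumulants, satisfy the same recursion linking [j] to [j.+1]. The step to [j.+1] is
    multiplied by [w], hence by [pX], so induction on the order of agreement, for all [j] at once,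
    identifies them. *)
Lemma cfree_seq_eq (r Rc : pser K) (s := (cfree_seq r r : pser K)) (st := (cfree_seq r Rc : pser K)) :
  st = 1 + pX * st * ps_comp (pshift Rc) (pX * s).
Proof.
set w := pX * s.
have w0 : w 0%N = 0 by rewrite /w pserXM.
pose F j : pser K := marked_seq r Rc j.
pose T j : pser K := fun k => Rc (k + j).+1.
have st0 : st = 1 + pX * F 0%N.
  apply: pserP => -[|n]; rewrite pserD pserXM pser1E /= ?addr0 ?add0r.
    by rewrite /st cfree_seq0.
  exact: cfree_seqS.
have FE j : F j = pC (Rc j.+1) * st + w * F j.+1.
  apply: pserP => n; rewrite pserD pserCM /w -mulrA pserXM /F marked_seq_rec.
  congr (_ + _); case: n => [|n]; first by rewrite big_ord0.
  rewrite mulrC pserM; apply: eq_bigr => i _; have ? := ltn_ord i.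
  by rewrite subSS.
have TE j : ps_comp (T j) w = pC (Rc j.+1) + w * ps_comp (T j.+1) w.
  rewrite ps_comp_shift //; congr (_ + _ * ps_comp _ _).
  by apply: pserP => n; rewrite /pshift /T addnS addSn.
have D m j : agree m (F j) (st * ps_comp (T j) w).
  elim: m j => [//|m IH] j; rewrite FE TE mulrDr.
  apply: agreeD; first by rewrite mulrC; apply: agree_refl.
  have -> : st * (w * ps_comp (T j.+1) w) = pX * (s * (st * ps_comp (T j.+1) w)).
    by rewrite /w; ring.
  by rewrite /w -mulrA; apply/agreeX/agreeM/IH; apply: agree_refl.
rewrite {1}st0 (agreeP (fun m => D m 0%N)) mulrA; congr (1 + _ * ps_comp _ _).
by apply: pserP => n; rewrite /T addn0.
Qed.

End CumulantSeries.

(** * Uniqueness of solutions and comparison at the first differing order *)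

Section SeriesEquations.
Variable K : comNzRingType.
Implicit Types (f g s st T rho : pser K).

(** The uniqueness half of Banach's fixed point theorem in the [X]-adic metric. *)
Lemma contract_uniq (Phi : pser K -> pser K) f g :
  (forall m u v, agree m u v -> agree m.+1 (Phi u) (Phi v)) ->
  f = Phi f -> g = Phi g -> f = g.
Proof.
move=> PhiC fE gE; apply: agreeP; elim=> [//|m IH].
by rewrite fE gE; apply: PhiC.
Qed.

(** Division by a series with constant term 1 is the fixed point problem
    [u = st * g - pX * (pshift st * u)]. *)
Lemma unit_cancel st f g : st 0%N = 1 -> st * f = st * g -> f = g.
Proof.
move=> st0 e; apply: (@contract_uniq (fun u => st * g - pX * (pshift st * u))).
- move=> m u v uv; apply: agreeD => //.
  by move=> n nm; rewrite !pserN (agreeX (agreeM (@agree_refl _ _ _) uv)).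
- by rewrite -e {1}(pshiftK st) st0 rmorph1; ring.
- by rewrite {1}(pshiftK st) st0 rmorph1; ring.
Qed.

Lemma topMr m f f' g g' : agree m.+1 f f' -> agree m g g' ->
  (f * g) m - (f' * g') m = f 0%N * (g m - g' m).
Proof.
move=> h k; rewrite !pserM !big_ord_recl /= subn0 -h //.
under [X in _ - (_ + X)]eq_bigr => i _.
  have ? := ltn_ord i; rewrite -h -?k; [over|by rewrite /bump; lia|by rewrite /bump; lia].
by rewrite mulrBr; ring.
Qed.

(** [T] stands for the cumulants shifted by one order. The case [st = s] is the relation for free
    cumulants. *)
Definition cfree_eq T s st := st = 1 + pX * st * ps_comp T (pX * s).

Lemma cfree_eq0 T s st : cfree_eq T s st -> st 0%N = 1.
Proof. by move=> ->; rewrite pserD -mulrA pserXM addr0. Qed.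

Lemma cfree_eq_uniq T s st st' : cfree_eq T s st -> cfree_eq T s st' -> st = st'.
Proof.
apply: (@contract_uniq (fun u => 1 + pX * u * ps_comp T (pX * s))) => m u v uv.
by apply: agreeD => //; rewrite -!mulrA; apply/agreeX/agreeM.
Qed.

Lemma free_eq_uniq T s s' : cfree_eq T s s -> cfree_eq T s' s' -> s = s'.
Proof.
apply: (@contract_uniq (fun u => 1 + pX * u * ps_comp T (pX * u))) => m u v uv.
apply: agreeD => //; rewrite -!mulrA; apply/agreeX/agreeM => //.
by apply/agree_comp => //; apply: agreeW (agreeX uv).
Qed.

(** The unit [st] can be cancelled, and composition with [pX * s] is injective because [topcomp]
    recovers the coefficients one by one. This identifies the cumulants chosen independently for
    different powers. *)
Lemma cfree_eq_inj T T' s st : s 0%N = 1 ->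
  cfree_eq T s st -> cfree_eq T' s st -> T = T'.
Proof.
move=> s0 h h'; have st0 := cfree_eq0 h.
have e : ps_comp T (pX * s) = ps_comp T' (pX * s).
  apply: (unit_cancel st0); apply: pXI; rewrite !mulrA.
  by apply: (@addrI _ (1 : pser K)); rewrite -[LHS]h -[RHS]h'.
apply: agreeP; elim=> [//|m IH]; apply: agreeS => //.
apply/eqP; rewrite -subr_eq0; apply/eqP.
rewrite -(@topcomp _ m T T' (pX * s) (pX * s)) //; rewrite ?pserXM //.
by rewrite e subrr.
Qed.

(** [T m] is the free cumulant of order [m.+1]: it enters the moment of that order with factor 1 and
    no lower moment. *)
Lemma free_eq_agree T T' s s' m : cfree_eq T s s -> cfree_eq T' s' s' ->
  agree m T T' -> agree m.+1 s s' /\ s m.+1 - s' m.+1 = T m - T' m.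
Proof.
move=> h h' TT.
have ss k : (k <= m)%N -> agree k.+1 s s'.
  elim: k => [|k IH] km.
    by move=> [|//] _; rewrite (cfree_eq0 h) (cfree_eq0 h').
  have IH' := IH (ltnW km).
  rewrite h h'; apply: agreeD => //; rewrite -!mulrA; apply/agreeX/agreeM => //.
  apply: agree_comp; first exact: agreeW TT.
  by apply: agreeW (agreeX IH').
split; first exact: ss.
have s0 := cfree_eq0 h.
rewrite {1}h {1}h' !pserD !pser1E !add0r -!mulrA !pserXM.
have w1 : (pX * s) 1%N = 1 by rewrite pserXM.
have ww : agree m.+2 (pX * s) (pX * s') by apply/agreeX/ss.
rewrite topMr; first last.
- by apply: agree_comp => //; apply: (agreeW (leqW (leqnSn m)) ww).
- exact: ss.
by rewrite s0 mul1r (@topcomp _ m T T') ?pserXM //; apply: (agreeW (leqnSn _) ww).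
Qed.

Section JacobiMoments.
Implicit Types (beta gamma : nat -> K).

(* The coefficient of [P m] in the expansion of ['X^k]. *)
Fixpoint jcoef beta gamma k m : K :=
  if k is k'.+1 then
    (if m is m'.+1 then jcoef beta gamma k' m' else 0) +
    beta m * jcoef beta gamma k' m + gamma m * jcoef beta gamma k' m.+1
  else (m == 0%N)%:R.

Definition jmom beta gamma : pser K := fun k => jcoef beta gamma k 0%N.

Definition tail (u : nat -> K) : nat -> K := fun m => u m.+1.

(** [jcoef beta gamma k m] counts weighted Motzkin paths from level 0 to level [m]; the
    factorization cuts such a path after its last visit to level 0. The proof compares the
    recursions of both sides, each driven by a factor [pX]. *)
Lemma jcoef_strip beta gamma m :
  (fun k => jcoef beta gamma k m.+1) =
  pX * jmom beta gamma * (fun k => jcoef (tail beta) (tail gamma) k m) :> pser K.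
Proof.
pose A m : pser K := fun k => jcoef beta gamma k m.
pose A' m : pser K := fun k => jcoef (tail beta) (tail gamma) k m.
rewrite -/(A m.+1) -/(A' m) -/(A 0%N).
have AS i : A i.+1 = pX * (A i + pC (beta i.+1) * A i.+1 + pC (gamma i.+1) * A i.+2).
  by apply: pserP => -[|k]; rewrite pserXM ?pserD ?pserCM.
have A'0 : A' 0%N = 1 + pX * (pC (beta 1%N) * A' 0%N + pC (gamma 1%N) * A' 1%N).
  apply: pserP => -[|k]; rewrite pserD pserXM pser1E ?addr0 //.
  by rewrite /A' /= !add0r pserD !pserCM.
have A'S i : A' i.+1 = pX * (A' i + pC (beta i.+2) * A' i.+1 + pC (gamma i.+2) * A' i.+2).
  by apply: pserP => -[|k]; rewrite pserXM ?pserD ?pserCM.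
apply: agreeP => n; elim: n m => [//|n IH] [|m].
  have -> : pX * A 0%N * A' 0%N =
      pX * (A 0%N + pC (beta 1%N) * (pX * A 0%N * A' 0%N) + pC (gamma 1%N) * (pX * A 0%N * A' 1%N)).
    by rewrite {1}A'0; ring.
  by rewrite [A 1%N]AS; apply/agreeX/agreeD; [apply: agreeD => //|]; apply: agreeM.
have -> : pX * A 0%N * A' m.+1 =
    pX * (pX * A 0%N * A' m + pC (beta m.+2) * (pX * A 0%N * A' m.+1) +
          pC (gamma m.+2) * (pX * A 0%N * A' m.+2)).
  by rewrite {1}A'S; ring.
rewrite [A m.+2]AS; apply/agreeX/agreeD; [apply: agreeD => //|]; exact: agreeM.
Qed.

(** One step of the continued fraction [M = 1 / (1 - beta_0 z - gamma_0 z^2 M1)], cleared of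
    denominators. *)
Lemma jmom_cf beta gamma (M := jmom beta gamma) (M1 := jmom (tail beta) (tail gamma)) :
  M = 1 + pC (beta 0%N) * (pX * M) + pC (gamma 0%N) * (pX * (pX * (M * M1))).
Proof.
have e k : jcoef beta gamma k 1%N = (pX * (M * M1)) k.
  by rewrite mulrA -jcoef_strip.
apply: pserP => -[|k]; rewrite !pserD !pserCM !pserXM pser1E ?mulr0 ?addr0 //=.
by rewrite -pserXM -e add0r {1}/M /jmom /= add0r.
Qed.

Lemma jmom0 beta gamma : jmom beta gamma 0%N = 1. Proof. by []. Qed.

Lemma jmom_uniq beta gamma (M1 := jmom (tail beta) (tail gamma)) f :
  f = 1 + pC (beta 0%N) * (pX * f) + pC (gamma 0%N) * (pX * (pX * (f * M1))) ->
  f = jmom beta gamma.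
Proof.
pose Phi u : pser K := 1 + pC (beta 0%N) * (pX * u) + pC (gamma 0%N) * (pX * (pX * (u * M1))).
move=> fE; apply: (@contract_uniq Phi) => // [m u v uv|]; last exact: jmom_cf.
apply: agreeD; first by apply: agreeD => //; apply/agreeM/agreeX.
apply/agreeM/agreeX => //; apply: agreeW (agreeX _) => //.
exact: agreeM.
Qed.

(* The parameters read in the order beta 0, gamma 0, beta 1, gamma 1, ... in
   which the moments involve them. *)
Definition jseq beta gamma n := if odd n then gamma n./2 else beta n./2.

Lemma jseqSS beta gamma n : jseq beta gamma n.+2 = jseq (tail beta) (tail gamma) n.
Proof. by rewrite /jseq /= negbK. Qed.

(** Each induction step strips one [beta] and one [gamma]: by [jmom_cf], the difference of the
    moments of order [n.+3] is [gamma 0] times the difference of the stripped moments of order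
    [n.+1]. This produces the product of the [gamma i]. *)
Lemma jmom_top n beta gamma beta' gamma' :
  (forall k, (k < n)%N -> jseq beta gamma k = jseq beta' gamma' k) ->
  agree n.+1 (jmom beta gamma) (jmom beta' gamma') /\
  jmom beta gamma n.+1 - jmom beta' gamma' n.+1 =
    (\prod_(i < n./2) gamma i) * (jseq beta gamma n - jseq beta' gamma' n).
Proof.
elim/ltn_ind: n beta gamma beta' gamma' => -[|[|n]] IH beta gamma beta' gamma' h.
- split; first by case.
  rewrite big_ord0 mul1r /jseq /= /jmom /=.
  by rewrite !mulr0 !addr0 !add0r !mulr1.
- have := h 0%N isT; rewrite /jseq /= => e0.
  split; first by case=> [|[|]] //= _; rewrite /jmom /= e0 !mulr0 !addr0 !add0r.
  by rewrite /jmom /= big_ord0 e0; ring.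
have h1 k : (k < n)%N -> jseq (tail beta) (tail gamma) k = jseq (tail beta') (tail gamma') k.
  by move=> kn; rewrite -!jseqSS h.
have [A1 top1] := IH n (leqnSn n.+1) (tail beta) (tail gamma) (tail beta') (tail gamma') h1.
have b0 : beta 0%N = beta' 0%N := h 0%N isT.
have g0 : gamma 0%N = gamma' 0%N := h 1%N isT.
set M := jmom beta gamma in top1 *; set M' := jmom beta' gamma' in top1 *.
have AM k : (k <= n.+3)%N -> agree k M M'.
  elim: k => [//|k IHk] kn; have A := IHk (ltnW kn).
  rewrite /M /M' jmom_cf [jmom beta' gamma']jmom_cf -/M -/M' -b0 -g0.
  apply: agreeD; first by apply: agreeD => //; apply/agreeM/agreeX.
  apply: agreeM => //; apply: agreeX; case: k A {IHk} kn => [//|k] A kn.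
  by apply/agreeX/agreeM; [apply: agreeW A|apply: agreeW A1].
split; first exact: AM.
rewrite /M /M' jmom_cf [jmom beta' gamma']jmom_cf -/M -/M' -b0 -g0.
rewrite !pserD !pserCM !pserXM !pser1E /= (AM n.+3) //.
have := topMr (AM n.+2 (leqnSn _)) A1; rewrite top1 [M 0%N]jmom0 mul1r !jseqSS => topn.
rewrite big_ord_recl /= -mulrA -topn; ring.
Qed.

End JacobiMoments.

(** [jmom_cf] and the cumulant relation both have the form [M = 1 + z M (...)]; cancelling the unit
    [M] equates the brackets. The first two cumulants are the mean and the variance, and the rest of
    [T] governs the stripped moments. *)
Lemma cfree_eq_strip T s beta gamma :
  cfree_eq T s (jmom beta gamma) -> s 0%N = 1 ->
  [/\ beta 0%N = T 0%N, gamma 0%N = T 1%N &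
    pC (gamma 0%N) * jmom (tail beta) (tail gamma) = s * ps_comp (pshift T) (pX * s)].
Proof.
move=> h s0; set M := jmom beta gamma in h *; set M1 := jmom (tail _) _.
have w0 : (pX * s) 0%N = 0 by rewrite pserXM.
have e : pC (beta 0%N) + pX * (pC (gamma 0%N) * M1) = pC (T 0%N) + pX * (s * ps_comp (pshift T) (pX * s)).
  apply: (@unit_cancel M) => //; apply: pXI.
  apply: (@addrI _ (1 : pser K)).
  have -> : 1 + pX * (M * (pC (T 0%N) + pX * (s * ps_comp (pshift T) (pX * s)))) = M.
    by rewrite {2}h (ps_comp_shift T w0); ring.
  by rewrite {2}/M jmom_cf -/M -/M1; ring.
have b0 : beta 0%N = T 0%N.
  by move/(congr1 (fun f => f 0%N)): e; rewrite !pserD !pserXM !addr0.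
have e1 : pC (gamma 0%N) * M1 = s * ps_comp (pshift T) (pX * s).
  by apply: pXI; move: e; rewrite b0 => /addrI.
split=> //; move/(congr1 (fun f => f 0%N)): e1.
rewrite pserCM pserM0 s0 mul1r mulr1 => ->.
by rewrite (ps_comp_shift (pshift T) w0) pserD -mulrA pserXM addr0.
Qed.

End SeriesEquations.

(** * The free Meixner families and their cumulants *)

Section Meixner.
Variables (K : realType) (bt ct b c : K).

Definition sigma := jmom (fun=> b) (fun=> c).
Definition mrho := jmom (row2 bt b) (row2 ct c).

Lemma sigma_comp (w : pser K) : w 0%N = 0 -> ps_comp sigma w =
  1 + pC b * (w * ps_comp sigma w) + pC c * (w * (w * (ps_comp sigma w * ps_comp sigma w))).
Proof.
move=> w0; rewrite {1}/sigma jmom_cf -/sigma.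
by rewrite !ps_compD !(ps_compM _ _ w0) !ps_compC (ps_compX w0) rmorph1.
Qed.

Lemma rho_comp (w : pser K) : w 0%N = 0 -> ps_comp mrho w =
  1 + pC bt * (w * ps_comp mrho w) + pC ct * (w * (w * (ps_comp mrho w * ps_comp sigma w))).
Proof.
move=> w0; rewrite {1}/mrho jmom_cf -/mrho.
by rewrite !ps_compD !(ps_compM _ _ w0) !ps_compC (ps_compX w0) rmorph1.
Qed.

Variables (b0 g0 : K).
(* [M], [N], [Mt1] play the roles of the moment series of mu, of mu stripped of
   its first parameters, and of the stripped mut. *)
Let M := jmom (row2 b0 (b + b0)) (row2 g0 (c + g0)).
Let N := jmom (fun=> b + b0) (fun=> c + g0).
Let Mt1 := jmom (row2 (bt + b0) (b + b0)) (row2 (ct + g0) (c + g0)).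
Let w := pX * M.

Let w0 : w 0%N = 0. Proof. by rewrite /w pserXM. Qed.

Let M_eq : M = 1 + pC b0 * (pX * M) + pC g0 * (pX * (pX * (M * N))).
Proof. by rewrite {1}/M jmom_cf. Qed.

(** The series [N] solves a quadratic equation. Freezing one factor [N] in the term with [g0] gives
    a fixed point equation that [M * ps_comp sigma w] satisfies too: multiply the equation of [M] by
    [ps_comp sigma w] and insert the equation of [sigma] at [w]. *)
Lemma stripped_sigma : N = M * ps_comp sigma w.
Proof.
pose Phi u : pser K := 1 + pC (b + b0) * (pX * u) + pC c * (pX * (pX * (u * u))) +
   pC g0 * (pX * (pX * (u * N))).
apply: (@contract_uniq _ Phi).
- move=> m u v uv; apply: agreeD; first apply: agreeD.
  + by apply: agreeD => //; apply/agreeM/agreeX.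
  + by apply/agreeM/agreeX => //; apply: agreeW (agreeX _) => //; apply: agreeM.
  + by apply/agreeM/agreeX => //; apply: agreeW (agreeX _) => //; apply: agreeM.
- by rewrite {1}/N jmom_cf -/N /Phi !rmorphD; ring.
set S := ps_comp sigma w; have SE : S = _ := sigma_comp w0.
have e : M * S = S + pC b0 * (pX * (M * S)) + pC g0 * (pX * (pX * (M * S * N))).
  by rewrite {1}M_eq; ring.
by rewrite {1}e {1}SE /Phi /w rmorphD -/S /=; ring.
Qed.

Lemma stripped_rho : Mt1 = M * ps_comp mrho w.
Proof.
symmetry; apply: jmom_uniq.
set S := ps_comp mrho w; have SE : S = _ := rho_comp w0.
have e : M * S = S + pC b0 * (pX * (M * S)) + pC g0 * (pX * (pX * (M * S * N))).
  by rewrite {1}M_eq; ring.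
have e2 : ps_comp sigma w * M = N by rewrite stripped_sigma mulrC.
have -> : jmom (tail (row2 (bt + b0) (b + b0))) (tail (row2 (ct + g0) (c + g0))) = N by [].
rewrite {1}e {1}SE -/S -e2 /= !rmorphD /=; rewrite /w; ring.
Qed.

End Meixner.

Section MeixnerPowers.
Variables (R : realType) (b0 g0 bt0 gt0 bt ct b c : R).

Definition meixner_T : pser R := pC b0 + pC g0 * (pX * sigma b c).
Definition meixner_TR : pser R := pC bt0 + pC gt0 * (pX * mrho bt ct b c).
Definition meixner_s t := jmom (row2 (b0 * t) (b + b0 * t)) (row2 (g0 * t) (c + g0 * t)).
Definition meixner_st t := jmom (row3 (bt0 * t) (bt + b0 * t) (b + b0 * t))
                                (row3 (gt0 * t) (ct + g0 * t) (c + g0 * t)).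

(** Stripping leaves [M sigma(z M)] with [sigma] free of [t]. So [t] remains only as a common factor
    of [b0] and [g0] in the first step of the continued fraction. *)
Lemma meixner_free t : cfree_eq (pC t * meixner_T) (meixner_s t) (meixner_s t).
Proof.
rewrite /cfree_eq; set M := meixner_s t; set w := pX * M.
have w0 : w 0%N = 0 by rewrite /w pserXM.
rewrite {1}/M /meixner_s jmom_cf -/(meixner_s t) -/M.
rewrite (stripped_sigma b c (b0 * t) (g0 * t)) -/(meixner_s t) -/M.
rewrite /meixner_T !(ps_compM _ _ w0) ps_compD !(ps_compM _ _ w0) !ps_compC (ps_compX w0).
by rewrite /= !rmorphM /= /w; ring.
Qed.

Lemma meixner_cfree t : cfree_eq (pC t * meixner_TR) (meixner_s t) (meixner_st t).
Proof.
rewrite /cfree_eq; set M := meixner_s t; set Mt := meixner_st t; set w := pX * M.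
have w0 : w 0%N = 0 by rewrite /w pserXM.
have M1E : jmom (tail (row3 (bt0 * t) (bt + b0 * t) (b + b0 * t)))
     (tail (row3 (gt0 * t) (ct + g0 * t) (c + g0 * t))) = M * ps_comp (mrho bt ct b c) w.
  rewrite -(stripped_rho bt ct b c (b0 * t) (g0 * t)).
  by congr jmom; apply: funext => -[].
rewrite {1}/Mt /meixner_st jmom_cf -/(meixner_st t) -/Mt M1E.
rewrite /meixner_TR !(ps_compM _ _ w0) ps_compD !(ps_compM _ _ w0) !ps_compC (ps_compX w0).
by rewrite /= !rmorphM /= /w; ring.
Qed.

End MeixnerPowers.

(** * Rigidity of parameters that are polynomials in [t] *)

Section PolynomialParameters.
Variable R : realType.

Lemma poly_eq_nat (p q : {poly R}) :
  (forall t : nat, (0 < t)%N -> p.[t%:R] = q.[t%:R]) -> p = q.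
Proof.
move=> h; apply/eqP; rewrite -subr_eq0; apply/negPn/negP => pq.
pose n := size (p - q); pose s := [seq (i.+1)%:R : R | i <- iota 0 n].
have : (size s < n)%N.
  apply: max_poly_roots => //.
    apply/allP => _ /mapP[i _ ->].
    by rewrite rootE hornerD hornerN h // subrr.
  rewrite map_inj_uniq ?iota_uniq // => i j /eqP.
  by rewrite eqr_nat => /eqP[].
by rewrite size_map size_iota ltnn.
Qed.

Lemma size_prod_eq2 (F : nat -> {poly R}) n :
  (forall i, (i < n)%N -> size (F i) = 2%N) -> size (\prod_(i < n) F i) = n.+1.
Proof.
elim: n => [|n IH] h; first by rewrite big_ord0 size_poly1.
have IHn := IH (fun i hi => h i (ltnW hi)).
rewrite big_ord_recr /= size_mul -?size_poly_gt0 ?IHn ?h //.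
by rewrite addnS addn1.
Qed.

Variables (betat gammat beta gamma : nat -> R) (T TR : pser R) (B C : nat -> {poly R}).
Hypotheses (gammat0 : gammat 0%N != 0) (gamma0 : gamma 0%N != 0).
Hypothesis mu_eq : cfree_eq T (jmom beta gamma) (jmom beta gamma).
Hypothesis mut_eq : cfree_eq TR (jmom beta gamma) (jmom betat gammat).
Hypothesis powers : forall t : nat, (0 < t)%N -> exists s : pser R,
  cfree_eq (pC t%:R * T) s s /\
  cfree_eq (pC t%:R * TR) s
    (jmom (fun m => (B m).[t%:R]) (fun m => (C m).[t%:R])).

Let b0 := beta 0%N.
Let g0 := gamma 0%N.
Let bt := betat 1%N - b0.
Let ct := gammat 1%N - g0.
Let b := beta 1%N - b0.
Let c := gamma 1%N - g0.
Let T0 := meixner_T b0 g0 b c.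
Let rho0 := mrho bt ct b c.
(** Normalized by [TR 1 = gammat 0], so that the constant term is 1, as for its Meixner candidate
    [rho0]. *)
Let rho : pser R := pC (gammat 0%N)^-1 * pshift TR.
Let s0 (t : R) := meixner_s b0 g0 b c t.
Let s1 (t : R) := jmom (row2 (bt + b0 * t) (b + b0 * t)) (row2 (ct + g0 * t) (c + g0 * t)).

(** Parameters of the stripped Meixner [mut_t], as polynomials in [t]. Index [m] corresponds to
    parameter [m.+1] of [mut_t], which is why [jpoly] reads [B] and [C] one place later. *)
Let Bt0 : nat -> {poly R} := fun m =>
  if m is 0%N then bt%:P + b0 *: 'X else b%:P + b0 *: 'X.
Let Ct0 : nat -> {poly R} := fun m =>
  if m is 0%N then ct%:P + g0 *: 'X else c%:P + g0 *: 'X.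
Let jpoly n := if odd n then C n./2.+1 else B n./2.+1.
Let jpoly0 n := if odd n then Ct0 n./2 else Bt0 n./2.

Let s1E t : s1 t = s0 t * ps_comp rho0 (pX * s0 t).
Proof. exact: (stripped_rho bt ct b c (b0 * t) (g0 * t)). Qed.

Let s1_eval (t : R) : s1 t = jmom (fun m => (Bt0 m).[t]) (fun m => (Ct0 m).[t]).
Proof.
by rewrite /s1; congr jmom; apply: funext => -[|m] /=; rewrite !hornerE.
Qed.

Let TR1 : gammat 0%N = TR 1%N.
Proof. by have [] := cfree_eq_strip mut_eq (jmom0 _ _). Qed.

Let strip_orig : jmom (tail betat) (tail gammat) =
  jmom beta gamma * ps_comp rho (pX * jmom beta gamma).
Proof.
have [_ _ e] := cfree_eq_strip mut_eq (jmom0 _ _).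
set s := jmom beta gamma in e *.
have w0 : (pX * s) 0%N = 0 by rewrite pserXM.
rewrite /rho (ps_compM _ _ w0) ps_compC mulrCA -e mulrA -rmorphM /= mulVf //.
by rewrite rmorph1 mul1r.
Qed.

(** The first [gamma] parameter of the power is [t * gammat 0], so the factor [t] cancels and one
    series [rho] serves all powers. *)
Let strip_power (t : nat) (s : pser R) : (0 < t)%N -> cfree_eq (pC t%:R * T) s s ->
  cfree_eq (pC t%:R * TR) s (jmom (fun m => (B m).[t%:R]) (fun m => (C m).[t%:R])) ->
  jmom (tail (fun m => (B m).[t%:R])) (tail (fun m => (C m).[t%:R])) =
  s * ps_comp rho (pX * s).
Proof.
move=> t0 h h'; have [_ C0 e] := cfree_eq_strip h' (cfree_eq0 h).
have w0 : (pX * s) 0%N = 0 by rewrite pserXM.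
have tn0 : t%:R != 0 :> R by rewrite pnatr_eq0 -lt0n.
have shE : pshift (pC t%:R * TR) = pC t%:R * pshift TR.
  by apply: pserP => n; rewrite pserCM /pshift pserCM.
move: e; rewrite C0 pserCM -TR1 shE (ps_compM _ _ w0) ps_compC => e.
have u : pC (t%:R * gammat 0%N)^-1 * pC (t%:R * gammat 0%N) = 1 :> pser R.
  by rewrite -rmorphM /= mulVf ?rmorph1 // mulf_neq0.
rewrite -[LHS]mul1r -u -mulrA e /rho (ps_compM _ _ w0) ps_compC.
rewrite invfM rmorphM /=.
have v : pC t%:R^-1 * pC t%:R = 1 :> pser R by rewrite -rmorphM /= mulVf ?rmorph1.
transitivity ((pC t%:R^-1 * pC t%:R) * (s * (pC (gammat 0%N)^-1 * ps_comp (pshift TR) (pX * s)))).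
  by ring.
by rewrite v mul1r.
Qed.

(** At order [n.+1] the composition contributes the difference of [rho], while [s] contributes that
    of its cumulants [t * T n], multiplied by the constant term [rho 0 = 1]. Within the composition
    [s] is shifted by [pX], so its own difference is not yet visible there. *)
Let compare (t : R) n (s : pser R) : cfree_eq (pC t * T) s s ->
  agree n T T0 -> agree n.+1 rho rho0 ->
  (s * ps_comp rho (pX * s)) n.+1 - s1 t n.+1 =
    (rho n.+1 - rho0 n.+1) + t * (T n - T0 n).
Proof.
move=> h TT rr; have h0 := meixner_free b0 g0 b c t.
have tT : agree n (pC t * T) (pC t * T0) by apply: agreeM.
have [ss top] := free_eq_agree h h0 tT.
have s00 := cfree_eq0 h.
have w1 : (pX * s) 1%N = 1 by rewrite pserXM.
have ww : agree n.+2 (pX * s) (pX * s0 t) by apply/agreeX.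
have cc : agree n.+1 (ps_comp rho (pX * s)) (ps_comp rho0 (pX * s0 t)).
  by apply: agree_comp => //; apply: (agreeW (leqnSn _) ww).
rewrite s1E topM // s00 mul1r (@topcomp _ n.+1 rho rho0) ?pserXM //.
rewrite top !pserCM -mulrBr; congr (_ + _).
rewrite /ps_comp big_ord_recl big_ord0 addr0 expr0 pser1E mulr1.
have -> : rho 0%N = 1 by rewrite (rr 0%N).
by rewrite mulr1.
Qed.

(** By the choice of [b] and [c], the Meixner family at [t = 1] shares two rows of parameters with
    [mu], that is four moments and hence four cumulants. *)
Let T_low n : (n < 4)%N -> agree n T T0 -> T n = T0 n.
Proof.
move=> n4 TT.
have h0 := meixner_free b0 g0 b c 1; rewrite rmorph1 mul1r in h0.
have [ss top] := free_eq_agree mu_eq h0 TT.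
apply/eqP; rewrite -subr_eq0 -top subr_eq0; apply/eqP.
have [] := @jmom_top _ 4 beta gamma (row2 (b0 * 1) (b + b0 * 1)) (row2 (g0 * 1) (c + g0 * 1)).
  by do 4 ?[case=> //]; move=> *; rewrite /jseq /= /b /c ?mulr1 ?subrK.
by move=> /(_ n.+1 n4).
Qed.

(** By the choice of [bt] and [ct], the stripped [mut] shares its first row, hence two moments, with
    the Meixner family at [t = 1]. With [T_low], the only difference left in [compare] is that of
    [rho]. *)
Let rho_low n : (n < 2)%N -> agree n T T0 -> agree n.+1 rho rho0 -> rho n.+1 = rho0 n.+1.
Proof.
move=> n2 TT rr.
have mu1 : cfree_eq (pC 1 * T) (jmom beta gamma) (jmom beta gamma).
  by rewrite rmorph1 mul1r.
have := compare mu1 TT rr.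
rewrite (T_low _ TT) ?(ltn_trans n2) // subrr mulr0 addr0 -strip_orig.
have [A _] := @jmom_top _ 2 (tail betat) (tail gammat)
  (row2 (bt + b0 * 1) (b + b0 * 1)) (row2 (ct + g0 * 1) (c + g0 * 1))
  ltac:(by do 2 ?[case=> //]; move=> *; rewrite /jseq /= /bt /ct /tail ?mulr1 ?subrK).
by rewrite (A n.+1) // subrr => /esym/eqP; rewrite subr_eq0 => /eqP.
Qed.

(** [rho] is known one order further than [T], because [T n] and [rho n.+1] first show in the same
    stripped moment, that of order [n.+1]. They are two unknowns in one equation, which its
    dependence on [t] separates. *)
Let rigid n : [/\ agree n T T0, agree n.+1 rho rho0 &
  forall i, (i < n)%N -> jpoly i = jpoly0 i].
Proof.
elim: n => [|n [TT rr JJ]].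
  split=> // -[|//] _.
  by rewrite /rho pserCM /pshift -TR1 mulVf.
pose P := \prod_(i < n./2) Ct0 i.
pose E := jpoly n - jpoly0 n.
pose q := (rho n.+1 - rho0 n.+1)%:P + (T n - T0 n) *: 'X.
(* Both sides evaluate to the difference of the stripped moments of order [n.+1], by [jmom_top] on
   the left and by [compare] on the right. Agreement at all positive integers determines a
   polynomial. *)
have PEq : P * E = q.
  apply: poly_eq_nat => t t0; have [s [h h']] := powers t0.
  have := compare h TT rr; rewrite -(strip_power t0 h h') s1_eval.
  have [_ ->] := @jmom_top _ n (tail (fun m => (B m).[t%:R])) (tail (fun m => (C m).[t%:R]))
    (fun m => (Bt0 m).[t%:R]) (fun m => (Ct0 m).[t%:R])
    ltac:(by move=> k /JJ; rewrite /jpoly /jpoly0 /jseq /tail; case: ifP => _ ->).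
  rewrite /q hornerD hornerC hornerZ hornerX [X in _ = _ + X]mulrC => <-.
  rewrite hornerM /P /E horner_prod hornerD hornerN; congr (_ * _).
    apply: eq_bigr => i _; have ? := ltn_ord i.
    have := JJ i.*2.+1; rewrite /jpoly /jpoly0 /= odd_double /= uphalf_double => <- //.
    by lia.
  by rewrite /jpoly /jpoly0 /jseq /tail; case: ifP.
have sC i : (i < n./2)%N -> size (Ct0 i) = 2%N.
  move=> _; have sz x : size (x%:P + g0 *: 'X : {poly R}) = 2%N.
    rewrite addrC size_addl size_scale ?size_polyX //.
    by rewrite size_polyC; case: eqP.
  by case: i => [|i]; exact: sz.
have sP : size P = n./2.+1 by apply: size_prod_eq2.
(* If [E] were nonzero, [P * E] would have degree at least [n./2]. But [q] is 0 for [n < 2],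
   constant for [n < 4] and of degree at most 1 always. *)
have E0 : E = 0.
  apply/eqP/negPn/negP => En0.
  have sE : (0 < size E)%N by rewrite size_poly_gt0.
  have : size q = (n./2 + size E)%N.
    by rewrite -PEq size_mul -?size_poly_gt0 ?sP.
  case: (ltnP n 4) => n4.
    rewrite /q (T_low n4 TT) subrr scale0r addr0 size_polyC.
    case: (ltnP n 2) => n2; last by case: (_ != 0); lia.
    by rewrite (rho_low n2 TT rr) subrr eqxx /=; case: (size E) sE => [|k] // _; rewrite addnS.
  have : (size q <= 2)%N.
    rewrite (leq_trans (size_polyD _ _)) // geq_max size_polyC.
    rewrite (leq_trans (leq_b1 _)) //= (leq_trans (size_scale_leq _ _)) //.
    by rewrite size_polyX.
  by lia.
have q0 : q = 0 by rewrite -PEq E0 mulr0.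
(* The constant coefficient of [q] isolates [rho n.+1], the linear one [T n]. *)
have r1 : rho n.+1 = rho0 n.+1.
  apply/eqP; rewrite -subr_eq0; move/(congr1 (fun p : {poly R} => p`_0)): q0.
  by rewrite /q coefD coefC coefZ coefX /= mulr0 addr0 coef0 => ->.
have T1 : T n = T0 n.
  apply/eqP; rewrite -subr_eq0; move/(congr1 (fun p : {poly R} => p`_1)): q0.
  by rewrite /q coefD coefC coefZ coefX /= mulr1 add0r coef0 => ->.
split; [exact: agreeS|exact: agreeS|].
move=> i; rewrite ltnS leq_eqVlt => /orP[/eqP->|/JJ//].
by apply/eqP; rewrite -subr_eq0; apply/eqP.
Qed.

Lemma polynomial_powers_rigid : jmom beta gamma = s0 1 /\ jmom (tail betat) (tail gammat) = s1 1.
Proof.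
have TE : T = T0 by apply: agreeP => m; have [] := rigid m.
have rE : rho = rho0.
  by apply: agreeP => m; have [_ h _] := rigid m; apply: (agreeW (leqnSn _) h).
have sE : jmom beta gamma = s0 1.
  have h0 := meixner_free b0 g0 b c 1; rewrite rmorph1 mul1r in h0.
  by apply: free_eq_uniq h0; rewrite -/T0 -TE.
by split=> //; rewrite strip_orig sE rE s1E.
Qed.

End PolynomialParameters.

(** * Back from moment series to parameters *)

Section Coincide.
Variable R : realType.
Implicit Types beta gamma : nat -> R.

(** By [jmom_top], the first differing parameter would show in a moment, multiplied by nonzero
    [gamma i]. *)
Lemma jmom_inj beta gamma beta' gamma' n : jmom beta gamma = jmom beta' gamma' ->
  (forall i, (i < n./2)%N -> gamma i != 0) ->
  forall k, (k <= n)%N -> jseq beta gamma k = jseq beta' gamma' k.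
Proof.
move=> e g0; elim/ltn_ind => k IH kn.
have [|_] := @jmom_top _ k beta gamma beta' gamma'.
  by move=> i ik; apply: IH => //; apply: leq_trans (ltnW ik) kn.
rewrite e subrr => /esym/eqP; rewrite mulf_eq0 => /orP[|].
  move=> /prodf_eq0[i _ gi]; have := g0 i; rewrite gi => /(_ _)/negP[] //.
  by have := ltn_ord i; lia.
by rewrite subr_eq0 => /eqP.
Qed.

Lemma jmom_inj_row beta gamma beta' gamma' m : jmom beta gamma = jmom beta' gamma' ->
  (forall i, (i < m)%N -> gamma i != 0) -> beta m = beta' m /\ gamma m = gamma' m.
Proof.
move=> e g0.
have g0' i : (i < m.*2.+1./2)%N -> gamma i != 0 by move=> h; apply: g0; lia.
have := jmom_inj e g0'; move=> h; have := h m.*2 (leqnSn _); have := h m.*2.+1 (leqnn _).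
by rewrite /jseq /= odd_double /= uphalf_double doubleK.
Qed.

Lemma coincide_of_jmom betat gammat beta gamma
   (b := beta 1%N - beta 0%N) (c := gamma 1%N - gamma 0%N)
   (bt := betat 1%N - beta 0%N) (ct := gammat 1%N - gamma 0%N) :
  jmom beta gamma = jmom (row2 (beta 0%N * 1) (b + beta 0%N * 1)) (row2 (gamma 0%N * 1) (c + gamma 0%N * 1)) ->
  jmom (tail betat) (tail gammat) =
    jmom (row2 (bt + beta 0%N * 1) (b + beta 0%N * 1)) (row2 (ct + gamma 0%N * 1) (c + gamma 0%N * 1)) ->
  jacobi_coincide betat gammat beta gamma.
Proof.
move=> e e1 [//|m] _; split=> [def|def].
  by have [-> ->] := jmom_inj_row e def; rewrite /= /b /c !mulr1 !subrK.
have def' i : (i < m.+1)%N -> tail gammat i != 0 by move=> im; apply: def.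
by have := jmom_inj_row e1 def'; rewrite /tail /= /b /c !mulr1 !subrK.
Qed.

(* Conversely, the entries that [jacobi_coincide] leaves free do not matter. *)
Lemma jmom_ext beta gamma beta' gamma' :
  (forall n, (forall i, (i < n)%N -> gamma i != 0) -> beta n = beta' n /\ gamma n = gamma' n) ->
  jmom beta gamma = jmom beta' gamma'.
Proof.
move=> h; apply: agreeP => m.
elim: m beta gamma beta' gamma' h => [//|m IH] beta gamma beta' gamma' h.
have [b0 g0] := h 0%N (fun i (hi : (i < 0)%N) => match notF hi with end).
(* If [gamma 0] vanishes, the stripped series drops out of the continued fraction and the tails may
   differ. *)
case: (eqVneq (gamma 0%N) 0) => [gz|gn].
  suff -> : jmom beta gamma = jmom beta' gamma' by [].
  apply: jmom_uniq; rewrite -b0 -g0 {1}jmom_cf gz rmorph0 !mul0r //.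
have A1 : agree m (jmom (tail beta) (tail gamma)) (jmom (tail beta') (tail gamma')).
  by apply: IH => n gn'; apply: h => -[|i] //; apply: gn'.
have A0 : agree m (jmom beta gamma) (jmom beta' gamma') by apply: IH.
rewrite jmom_cf [jmom beta' gamma']jmom_cf -b0 -g0.
apply: agreeD; first by apply: agreeD => //; apply/agreeM/agreeX.
by apply/agreeM/agreeX => //; apply: (agreeW (leqnSn _)); apply/agreeX/agreeM.
Qed.

End Coincide.

(** * Jacobi parameters of a measure *)

Section MomentFunctional.
Variables (R : realType) (mu : prob_on_line R).
Hypothesis mu_moments : finite_moments mu.
Implicit Types (p q : {poly R}) (beta gamma : nat -> R).

Definition expect p : R := Rintegral mu setT (fun x : measurableTypeR R => p.[x]).

Lemma integrable_poly p :
  mu.-integrable setT (EFin \o (fun x : measurableTypeR R => p.[x])).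
Proof.
have h : mu.-integrable setT (fun x : measurableTypeR R =>
    (\sum_(i < size p) ((p`_i)%:E * (x ^+ i)%:E))%E).
  by apply: integrable_sum => // i _; apply: integrableZl => //; apply: mu_moments.
congr (integrable _ _ _): h; apply: funext => x /=.
by rewrite [in RHS]horner_coef -sumEFin; apply: eq_bigr => i _; rewrite EFinM.
Qed.

Lemma expectD p q : expect (p + q) = expect p + expect q.
Proof.
rewrite /expect -RintegralD //; [|exact: integrable_poly|exact: integrable_poly].
by apply: eq_Rintegral => x _; rewrite hornerD.
Qed.

Lemma expectZ a p : expect (a *: p) = a * expect p.
Proof.
rewrite /expect -RintegralZl //; last exact: integrable_poly.
by apply: eq_Rintegral => x _; rewrite hornerZ.
Qed.

Lemma expectB p q : expect (p - q) = expect p - expect q.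
Proof. by rewrite expectD -scaleN1r expectZ mulN1r. Qed.

Lemma expectXn k : expect 'X^k = moment mu k.
Proof. by apply: eq_Rintegral => x _; rewrite hornerXn. Qed.

Lemma expect0 : expect 0 = 0.
Proof. by rewrite -[0 : {poly R}](scale0r 0) expectZ mul0r. Qed.

Lemma expect_sum n (F : 'I_n -> {poly R}) : expect (\sum_(i < n) F i) = \sum_(i < n) expect (F i).
Proof. by elim/big_rec2: _ => [|i x p _ <-]; rewrite ?expect0 ?expectD. Qed.

Lemma expect_coef p n : (size p <= n)%N -> expect p = \sum_(i < n) p`_i * moment mu i.
Proof.
move=> pn; have -> : p = \sum_(i < n) p`_i *: 'X^i.
  apply/polyP => i; rewrite coef_sum.
  have [ilt|ige] := ltnP i n.
    rewrite (bigD1 (Ordinal ilt)) //= coefZ coefXn eqxx mulr1 big1 ?addr0 // => k.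
    by rewrite -val_eqE /= coefZ coefXn eq_sym => /negPf->; rewrite mulr0.
  rewrite (nth_default 0 (leq_trans pn ige)) big1 // => k _.
  by rewrite coefZ coefXn gtn_eqF ?mulr0 // (leq_trans (ltn_ord k)).
rewrite expect_sum; apply: eq_bigr => i _; rewrite expectZ expectXn; congr (_ * _).
rewrite coef_sum (bigD1 i) //= coefZ coefXn eqxx mulr1 big1 ?addr0 // => k.
by rewrite -val_eqE /= coefZ coefXn eq_sym => /negPf->; rewrite mulr0.
Qed.

Lemma expect_sqr_ge0 p : 0 <= expect (p ^+ 2).
Proof. by apply: Rintegral_ge0 => x _; rewrite horner_exp sqr_ge0. Qed.

Lemma moment0 : moment mu 0 = 1.
Proof.
rewrite /moment.
under eq_Rintegral => x _ do rewrite expr0.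
by rewrite Rintegral_cst //= probability_setT mul1r.
Qed.

Section Orthogonal.
Variables (beta gamma : nat -> R) (P : nat -> {poly R}).
Hypotheses (P0 : P 0%N = 1) (P1 : 'X * P 0%N = P 1%N + beta 0%N *: P 0%N).
Hypothesis PS : forall m : nat,
  'X * P m.+1 = P m.+2 + beta m.+1 *: P m.+1 + gamma m *: P m.

Lemma jcoef_low k m : (k < m)%N -> jcoef beta gamma k m = 0.
Proof.
elim: k m => [|k IH] [|m] //= km.
have [h1 h2 h3] : [/\ (k < m)%N, (k < m.+1)%N & (k < m.+2)%N] by split; lia.
by rewrite !IH // !mulr0 !addr0.
Qed.

Lemma jcoef_diag m : jcoef beta gamma m m = 1.
Proof.
elim: m => [//|m IH] /=.
by rewrite IH !jcoef_low ?mulr0 ?addr0.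
Qed.

(** Moving one factor ['X] onto [P m] and applying the recurrence lowers [k]; for [k = 0] the
    orthogonality to [P 0] decides. *)
Lemma orthogonal_expect : (forall m, expect (P m.+1) = 0) -> forall k m,
  expect ('X^k * P m) = (\prod_(i < m) gamma i) * jcoef beta gamma k m.
Proof.
move=> L0; elim=> [|k IH] m.
  rewrite mul1r; case: m => [|m]; last by rewrite L0 mulr0.
  by rewrite P0 big_ord0 mul1r -[1](expr0 'X) expectXn moment0.
rewrite exprSr -mulrA; case: m => [|m] /=.
  by rewrite P1 mulrDr -scalerAr expectD expectZ !IH big_ord1 big_ord0; ring.
rewrite PS !mulrDr -!scalerAr !expectD !expectZ !IH !big_ord_recr /=; ring.
Qed.

(** Here the recurrence lowers [m] instead, down to [P 0], where the moments are given. It has order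
    two, so consecutive [m] are treated together. *)
Lemma expect_orthogonal : (forall k, moment mu k = jmom beta gamma k) -> forall k m,
  expect ('X^k * P m) = (\prod_(i < m) gamma i) * jcoef beta gamma k m.
Proof.
move=> muE k m; move: k.
suff h : (forall k, expect ('X^k * P m) = (\prod_(i < m) gamma i) * jcoef beta gamma k m) /\
  (forall k, expect ('X^k * P m.+1) = (\prod_(i < m.+1) gamma i) * jcoef beta gamma k m.+1).
  by case: h.
elim: m => [|m [IH IH1]].
  have h0 k : expect ('X^k * P 0) = (\prod_(i < 0) gamma i) * jcoef beta gamma k 0.
    by rewrite P0 mulr1 expectXn muE big_ord0 mul1r.
  split=> // k.
  have -> : 'X^k * P 1%N = 'X^(k.+1) * P 0%N - beta 0%N *: ('X^k * P 0%N).
    by rewrite exprSr -mulrA P1 mulrDr -scalerAr addrK.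
  by rewrite expectB expectZ !h0 big_ord1 big_ord0 /=; ring.
split=> // k.
have -> : 'X^k * P m.+2 = 'X^(k.+1) * P m.+1 - beta m.+1 *: ('X^k * P m.+1) - gamma m *: ('X^k * P m).
  rewrite exprSr -mulrA PS !mulrDr -!scalerAr; ring.
by rewrite !expectB !expectZ IH !IH1 !big_ord_recr /=; ring.
Qed.

Lemma size_monic_recurrence m : (size (P m - 'X^m)%R <= m)%N.
Proof.
suff h : (size (P m - 'X^m)%R <= m)%N /\ (size (P m.+1 - 'X^(m.+1))%R <= m.+1)%N by case: h.
elim: m => [|m [IH IH1]].
  rewrite P0 expr0 subrr size_poly0; split=> //.
  have -> : P 1%N - 'X^1 = - (beta 0%N)%:P.
    have -> : P 1%N = 'X * P 0%N - beta 0%N *: P 0%N by rewrite P1 addrK.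
    rewrite P0 expr1 mulr1 -mul_polyC mulr1; ring.
  by rewrite size_polyN size_polyC; case: (_ == _).
split=> //.
have -> : P m.+2 - 'X^(m.+2) = 'X * (P m.+1 - 'X^(m.+1)) - beta m.+1 *: (P m.+1 - 'X^(m.+1))
   - beta m.+1 *: 'X^(m.+1) - gamma m *: (P m - 'X^m) - gamma m *: 'X^m.
  have -> : P m.+2 = 'X * P m.+1 - beta m.+1 *: P m.+1 - gamma m *: P m.
    by rewrite PS; ring.
  by rewrite -!mul_polyC !exprS; ring.
have sZ (a : R) (p : {poly R}) n : (size p <= n -> size (- (a *: p))%R <= n)%N.
  by move=> h; rewrite size_polyN (leq_trans (size_scale_leq _ _)).
have sD (p q : {poly R}) n : (size p <= n -> size q <= n -> size (p + q)%R <= n)%N.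
  by move=> h h'; rewrite (leq_trans (size_polyD _ _)) // geq_max h.
apply: (sD); last by apply: sZ; rewrite size_polyXn ltnW.
apply: (sD); last by apply: sZ; rewrite (leq_trans IH) // ltnW // ltnW.
apply: (sD); last by apply: sZ; rewrite size_polyXn.
apply: (sD); last by apply: sZ; apply: ltnW.
rewrite (leq_trans (size_polyMleq _ _)) // size_polyX; lia.
Qed.

Lemma size_recurrence m : (size (P m) <= m.+1)%N.
Proof.
rewrite -[P m](subrK 'X^m) (leq_trans (size_polyD _ _)) // geq_max size_polyXn leqnn andbT.
exact/leqW/size_monic_recurrence.
Qed.

Lemma orthogonal_low : (forall k, moment mu k = jmom beta gamma k) ->
  forall p m, (size p <= m)%N -> expect (p * P m) = 0.
Proof.
move=> muE p m pm; have e := expect_orthogonal muE.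
rewrite -[p]coefK poly_def mulr_suml expect_sum big1 // => i _.
rewrite -scalerAl expectZ e jcoef_low ?mulr0 //.
exact: leq_trans (ltn_ord i) pm.
Qed.

(** [P m] differs from ['X^m] by terms of lower degree, which are orthogonal to [P m]. *)
Lemma expect_sqr_recurrence : (forall k, moment mu k = jmom beta gamma k) ->
  forall m, expect (P m ^+ 2) = \prod_(i < m) gamma i.
Proof.
move=> muE m; rewrite expr2 -{1}[P m](subrK 'X^m) mulrDl expectD.
rewrite orthogonal_low //; last exact: size_monic_recurrence.
by rewrite add0r expect_orthogonal // jcoef_diag mulr1.
Qed.

End Orthogonal.

Fixpoint monic_pair beta gamma m : {poly R} * {poly R} :=
  if m is m'.+1 then
    let: (p, q) := monic_pair beta gamma m' in (q, ('X - (beta m'.+1)%:P) * q - gamma m' *: p)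
  else (1, 'X - (beta 0%N)%:P).

(** After this equivalence only moments matter. Orthogonality to [P 0] fixes all moments;
    conversely, the polynomials generated by the recurrence are orthogonal, since each of them
    annihilates all polynomials of lower degree. *)
Lemma is_jacobi_jmom beta gamma : is_jacobi mu beta gamma <->
  (forall k, moment mu k = jmom beta gamma k).
Proof.
split=> [[P [P0 P1 PS orth]] k|muE].
  have L0 m : expect (P m.+1) = 0.
    by rewrite -(orth m.+1 0%N) //; apply: eq_Rintegral => x _; rewrite P0 hornerC mulr1.
  by rewrite -expectXn -[X in expect X]mulr1 -P0 (orthogonal_expect P0 P1 PS L0) big_ord0 mul1r.
pose P m := (monic_pair beta gamma m).1.
have PS2 m : (monic_pair beta gamma m).2 = P m.+1.
  by rewrite /P /=; case: (monic_pair beta gamma m).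
have P0 : P 0%N = 1 by [].
have P1 : 'X * P 0%N = P 1%N + beta 0%N *: P 0%N.
  by rewrite P0 -PS2 /= -mul_polyC; ring.
have PS m : 'X * P m.+1 = P m.+2 + beta m.+1 *: P m.+1 + gamma m *: P m.
  have -> : P m.+2 = ('X - (beta m.+1)%:P) * P m.+1 - gamma m *: P m.
    by rewrite -[LHS]PS2 -PS2 /P /=; case: (monic_pair beta gamma m).
  by rewrite -!mul_polyC; ring.
have orth i j : (i < j)%N -> expect (P i * P j) = 0.
  move=> ij; apply: (orthogonal_low P0 P1 PS muE).
  exact: leq_trans (size_recurrence P0 P1 PS i) ij.
exists P; split=> // i j; rewrite neq_ltn => /orP[ij|ji].
  by rewrite -(orth _ _ ij); apply: eq_Rintegral => x _; rewrite hornerM.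
by rewrite -(orth _ _ ji); apply: eq_Rintegral => x _; rewrite hornerM mulrC.
Qed.

Lemma prod_gamma_ge0 beta gamma m : is_jacobi mu beta gamma -> 0 <= \prod_(i < m) gamma i.
Proof.
move=> J; have muE := (is_jacobi_jmom beta gamma).1 J.
have [P [P0 P1 PS _]] := J.
by rewrite -(expect_sqr_recurrence P0 P1 PS muE); apply: expect_sqr_ge0.
Qed.

(** [gamma 0] is the integral of [(x - beta 0)^2]; if it vanishes, [x = beta 0] almost
    everywhere. *)
Lemma point_mass_gamma0 beta gamma : is_jacobi mu beta gamma -> gamma 0%N = 0 -> point_mass mu.
Proof.
move=> J g0; have muE := (is_jacobi_jmom beta gamma).1 J.
have [P [P0 P1 PS _]] := J.
have := expect_sqr_recurrence P0 P1 PS muE 1.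
have -> : P 1%N = 'X - (beta 0%N)%:P.
  have -> : P 1%N = 'X * P 0%N - beta 0%N *: P 0%N by rewrite P1 addrK.
  by rewrite P0 mulr1 -mul_polyC mulr1.
rewrite big_ord1 g0; set p := _ ^+ 2 => Lp.
have /integrableP[mp _] := integrable_poly p.
have p_ge0 x : 0 <= p.[x] by rewrite /p horner_exp sqr_ge0.
have int0 : (\int[mu]_x `|(EFin \o (fun x : measurableTypeR R => p.[x])) x| = 0)%E.
  under eq_integral => x _ do rewrite /= ger0_norm //.
  rewrite -[LHS]fineK; first by congr EFin.
  exact: integrable_fin_num (integrable_poly p).
have /(ae_eq_integral_abs mu measurableT mp) [N [mN N0 subN]] := int0.
exists (beta 0%N) => A mA.
have sub : (~` [set beta 0%N] `<=` N)%classic.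
  move=> x /= xb; apply: subN => /= /(_ I) [] /eqP.
  rewrite /p horner_exp sqrf_eq0 hornerD hornerN hornerC hornerX subr_eq0 => /eqP.
  exact: xb.
have mb : measurable [set (beta 0%N : measurableTypeR R)] by exact: measurable_set1.
have c0 : mu (~` [set beta 0%N])%classic = 0%E.
  apply/eqP; rewrite eq_le measure_ge0 andbT -N0.
  by apply: le_measure; rewrite ?inE //; apply: measurableC.
have b1 : mu [set beta 0%N]%classic = 1%E.
  by rewrite -[X in mu X]setCK probability_setC ?c0 ?sube0 //; apply: measurableC.
rewrite diracE; case: (boolP (_ \in A)) => [/set_mem bA|/negP bA] /=.
  suff -> : mu A = 1%E by [].
  apply/eqP; rewrite eq_le probability_le1 //= -b1.
  by apply: le_measure; rewrite ?inE // => _ ->.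
suff -> : mu A = 0%E by [].
apply/eqP; rewrite eq_le measure_ge0 andbT -c0.
apply: le_measure; rewrite ?inE //; first exact: measurableC.
by move=> x xA /= xb; apply: bA; rewrite inE -xb.
Qed.

End MomentFunctional.

(** * Existence of measures with given Jacobi parameters *)

From mathcomp Require Import complex measurable_realfun.

(** * Quadrature from truncated Jacobi matrices *)

Section Tridiagonal.
Variables (K : comNzRingType) (N : nat).
Implicit Types (a g : nat -> K) (v : 'rV[K]_N.+1).

Definition tridiag a g : 'M[K]_N.+1 := \matrix_(i, j)
  ((i == j :> nat)%:R * a j + (i.+1 == j :> nat)%:R * g i + (i == j.+1 :> nat)%:R * g j).

(** Extension by 0, which lets the three-term formula of [mul_tridiag] hold in the last column
    too. *)
Definition row_ext v m : K := if (m < N.+1)%N then v 0 (inord m) else 0.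

Lemma row_extE v (i : 'I_N.+1) : row_ext v i = v 0 i.
Proof. by rewrite /row_ext ltn_ord inord_val. Qed.

Lemma sum_row_ext v m : \sum_i v 0 i * (i == m :> nat)%:R = row_ext v m.
Proof.
rewrite /row_ext; case: ltnP => mN.
  rewrite (bigD1 (inord m)) //= inordK // eqxx mulr1 big1 ?addr0 // => i.
  by rewrite -val_eqE /= inordK // => /negPf->; rewrite mulr0.
rewrite big1 // => i _; rewrite ltn_eqF ?mulr0 //.
exact: leq_trans (ltn_ord i) mN.
Qed.

Lemma mul_tridiag a g v (j : 'I_N.+1) : (v *m tridiag a g) 0 j =
  (if nat_of_ord j is m.+1 then g m * row_ext v m else 0) +
  a j * row_ext v j + g j * row_ext v j.+1.
Proof.
rewrite mxE; under eq_bigr => i _ do rewrite mxE !mulrDr.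
rewrite !big_split /=; congr (_ + _); last first.
  rewrite -sum_row_ext big_distrr; apply: eq_bigr => i _ /=; ring.
rewrite addrC; congr (_ + _); last first.
  rewrite -sum_row_ext big_distrr; apply: eq_bigr => i _ /=; ring.
case: (nat_of_ord j) => [|m]; first by rewrite big1 // => i _; rewrite mul0r mulr0.
rewrite -sum_row_ext big_distrr; apply: eq_bigr => i _ /=.
by rewrite eqSS; case: eqP => [->|_]; rewrite ?mul0r ?mulr0 //; ring.
Qed.

End Tridiagonal.

Section Quadrature.
Variables (R : realType).
Implicit Types (beta gamma : nat -> R).
Local Notation sq gamma := (fun m => Num.sqrt (gamma m)).

(** Rescaling [jcoef] by [w m], the norm of the polynomial of degree [m], makes its recursion
    symmetric. Each multiplication reaches one level further, so the truncation is not felt during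
    the first [N] steps. *)
Lemma tridiag_moment beta gamma N k : (forall i, 0 <= gamma i) -> (k <= N)%N ->
  ((tridiag N beta (sq gamma)) ^+ k) 0 0 = jmom beta gamma k.
Proof.
move=> g0 kN; set J := tridiag _ _ _.
pose e0 : 'rV[R]_N.+1 := delta_mx 0 0.
pose w m := Num.sqrt (\prod_(i < m) gamma i).
have wS m : w m.+1 = w m * Num.sqrt (gamma m).
  by rewrite /w big_ord_recr /= sqrtrM // prodr_ge0.
have sqg m : Num.sqrt (gamma m) * Num.sqrt (gamma m) = gamma m.
  by rewrite -expr2 sqr_sqrtr.
have h l : (l <= N)%N -> forall m, row_ext (e0 *m J ^+ l) m = jcoef beta gamma l m * w m.
  elim: l => [|l IH] lN m.
    rewrite expr0 mulmx1 /row_ext.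
    case: ltnP => mN; last by rewrite /= gtn_eqF ?mul0r // (leq_trans _ mN).
    rewrite mxE eqxx /= -val_eqE /= inordK //.
    by case: m {mN} => [|m] /=; rewrite ?mul0r // mul1r /w big_ord0 sqrtr1.
  have IHl := IH (ltnW lN).
  rewrite exprSr mulmxA /row_ext; case: ltnP => mN; last first.
    by rewrite jcoef_low ?mul0r // (leq_trans _ mN).
  rewrite mul_tridiag inordK // !IHl; case: m mN => [|m] mN /=.
    rewrite wS !mulrDl mul0r -[in RHS](sqg 0%N); ring.
  rewrite !IHl [w m.+2]wS -[in RHS](sqg m.+1) [w m.+1]wS; ring.
rewrite [RHS](_ : _ = row_ext (e0 *m J ^+ k) 0%N); last first.
  by rewrite h // /w big_ord0 sqrtr1 mulr1.
rewrite -[0%N]/(nat_of_ord (0 : 'I_N.+1)) row_extE mxE (bigD1 0) //= mxE !eqxx mul1r.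
by rewrite big1 ?addr0 // => i /negPf i0; rewrite mxE eqxx i0 mul0r.
Qed.

(** Nodes are the eigenvalues, weights the squared moduli of the first coordinates of a unitary
    eigenbasis over [R[i]]. Eigenvectors are returned as well, because the nodes must be bounded
    independently of the size. *)
Lemma symmetric_quadrature N (J : 'M[R]_N.+1) : J^T = J -> exists (w x : 'I_N.+1 -> R),
  (forall i, 0 <= w i) /\ (forall k, \sum_i w i * x i ^+ k = (J ^+ k) 0 0) /\
  forall i, exists v : 'rV[R[i]]_N.+1, v != 0 /\
    v *m map_mx (real_complex R) J = (x i)%:C%C *: v.
Proof.
move=> Jsym; pose JC : 'M[R[i]]_N.+1 := map_mx (real_complex R) J.
have Jherm : JC \is hermsymmx.
  apply: realsym_hermsym.
    apply/is_hermitianmxP; rewrite expr0 scale1r map_mx_id //.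
    by apply/matrixP => i j; rewrite !mxE -[in RHS]Jsym mxE.
  by apply/mxOverP => i j; rewrite mxE; apply/complex_realP; eexists.
have /orthomx_spectralP JE := hermitian_normalmx Jherm.
have Xreal := hermitian_spectral_diag_real Jherm.
have Puni := spectral_unitarymx JC.
set P := spectralmx JC in JE Puni; set X := spectral_diag JC in JE Xreal.
have Punit := unitarymx_unit Puni.
have Xr i : exists r : R, X 0 i = r%:C%C.
  by apply/complex_realP; move/mxOverP: Xreal; apply.
pose x i := complex.Re (X 0 i).
have xE i : X 0 i = (x i)%:C%C by rewrite /x; have [r ->] := Xr i.
have PJ : P *m JC = diag_mx X *m P by rewrite [in LHS]JE !mulmxA mulmxV // mul1mx.
have PJk k : P *m JC ^+ k = diag_mx (map_mx (fun z => z ^+ k) X) *m P.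
  elim: k => [|k IH].
    rewrite expr0 mulmx1; have -> : map_mx (fun z => z ^+ 0) X = const_mx 1.
      by apply/rowP => i; rewrite !mxE expr0.
    by rewrite diag_const_mx mul1mx.
  rewrite exprSr mulmxA IH -mulmxA PJ mulmxA mulmx_diag; congr (diag_mx _ *m _).
  by apply/rowP => i; rewrite !mxE exprSr.
pose w i := complex.Re (`|P i 0| ^+ 2).
have wE i : (w i)%:C%C = `|P i 0| ^+ 2 by rewrite RRe_real // realX // normr_real.
exists w, x; split; [|split].
- by move=> i; rewrite -ler0c wE exprn_ge0.
- move=> k; apply: complexI; rewrite rmorph_sum.
  have -> : ((J ^+ k) 0 0)%:C%C = (JC ^+ k) 0 0.
    by rewrite /JC -rmorphXn /= mxE.
  have -> : JC ^+ k = invmx P *m (P *m JC ^+ k) by rewrite mulmxA mulVmx // mul1mx.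
  rewrite PJk invmx_unitary // mxE; apply: eq_bigr => i _.
  rewrite mul_diag_mx !mxE rmorphM rmorphXn /= wE -xE normCK; ring.
move=> i; exists (row i P); split.
  apply/eqP => r0; have := Punit; rewrite -row_free_unit => /row_freeP[Q PQ].
  have := congr1 (row i) PQ; rewrite row_mul r0 mul0mx => /rowP/(_ i).
  by rewrite !mxE eqxx => /eqP; rewrite eq_sym oner_eq0.
by rewrite -xE -row_mul PJ; apply/rowP => j; rewrite mxE mul_diag_mx !mxE.
Qed.

Lemma tridiag_sym (a g : nat -> R) N : (tridiag N a g)^T = tridiag N a g.
Proof.
apply/matrixP => i j; rewrite !mxE.
have -> : (j.+1 == i :> nat) = (i == j.+1 :> nat) by rewrite eq_sym.
have -> : (j == i.+1 :> nat) = (i.+1 == j :> nat) by rewrite eq_sym.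
rewrite eq_sym addrAC; congr (_ + _ + _); case: eqP => [e|_]; rewrite ?mul0r //.
by rewrite e.
Qed.

(** Gershgorin's argument: at the coordinate of [v] of largest modulus at most three matrix entries
    contribute, each bounded by [B]. *)
Lemma tridiag_eigen_bound (a g : nat -> R) N B x (v : 'rV[R[i]]_N.+1) :
  (forall i, `|a i| <= B) -> (forall i, `|g i| <= B) -> v != 0 ->
  v *m map_mx (real_complex R) (tridiag N a g) = x%:C%C *: v -> `|x| <= 3 * B.
Proof.
move=> aB gB vn0.
have -> : map_mx (real_complex R) (tridiag N a g) =
    tridiag N (fun i => (a i)%:C%C) (fun i => (g i)%:C%C).
  by apply/matrixP => i j; rewrite !mxE !rmorphD !rmorphM /= !rmorph_nat.
move=> vE.
have [i0 vi0] : exists i, v 0 i != 0.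
  case: (pickP (fun i => v 0 i != 0)) => [i h|h]; first by exists i.
  by case/eqP: vn0; apply/rowP => i; rewrite mxE; apply/eqP/negPn; rewrite h.
pose nv i : R := complex.Re `|v 0 i|.
have nvE i : `|v 0 i| = (nv i)%:C%C by rewrite RRe_real // normr_real.
case: (@arg_maxP _ _ _ i0 xpredT nv isT) => j _ jmax.
have nvj : 0 < nv j.
  apply: lt_le_trans (jmax i0 isT).
  by rewrite -ltcR -nvE normr_gt0.
have ext m : `|row_ext v m| <= (nv j)%:C%C.
  rewrite /row_ext; case: ifP => _; last by rewrite normr0 ler0c ltW.
  by rewrite nvE lecR; apply: jmax.
have B0 : 0 <= B by rewrite (le_trans _ (aB 0%N)).
have nC (r : R) : `|r%:C%C| = (`|r|)%:C%C by rewrite normc_def /= expr0n addr0 sqrtr_sqr.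
have term (c : R) m : `|c| <= B -> `|c%:C%C * row_ext v m| <= (B * nv j)%:C%C.
  move=> cB; rewrite normrM nC rmorphM /=; apply: ler_pM => //.
    by rewrite ler0c.
  by rewrite lecR.
have /rowP/(_ j) := vE; rewrite mul_tridiag [in RHS]mxE => e.
have : `|x%:C%C * v 0 j| <= ((3 * B) * nv j)%:C%C.
  rewrite -e (le_trans (ler_normD _ _)) //.
  have -> : ((3 * B) * nv j)%:C%C = (B * nv j)%:C%C + (B * nv j)%:C%C + (B * nv j)%:C%C.
    by rewrite -!rmorphD /=; congr (_%:C)%C; ring.
  apply: lerD; last exact: term.
  rewrite (le_trans (ler_normD _ _)) //; apply: lerD; last exact: term.
  case: (nat_of_ord j) => [|m]; last exact: term.
  by rewrite normr0 ler0c mulr_ge0 // ltW.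
by rewrite normrM nC nvE -rmorphM /= lecR ler_pM2r.
Qed.

Lemma jacobi_quadrature beta gamma B N : (forall i, 0 <= gamma i) ->
  (forall i, `|beta i| <= B) -> (forall i, Num.sqrt (gamma i) <= B) ->
  exists w x : 'I_N.+1 -> R, [/\ forall i, 0 <= w i, forall i, `|x i| <= 3 * B &
    forall k, (k <= N)%N -> \sum_i w i * x i ^+ k = jmom beta gamma k].
Proof.
move=> g0 bB gB.
have [w [x [w0 [mom eig]]]] := symmetric_quadrature (tridiag_sym beta (sq gamma) N).
exists w, x; split=> // [i|k kN]; last by rewrite mom tridiag_moment.
have [v [vn0 ve]] := eig i.
apply: tridiag_eigen_bound vn0 ve => // m.
by rewrite ger0_norm ?sqrtr_ge0.
Qed.

End Quadrature.

(** * Riemann sums of monotone functions and limits along an ultrafilter *)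

Section MonotoneIntegrals.
Import numFieldTopology.Exports numFieldNormedType.Exports.
Variable R : realType.
Implicit Types (f : R -> R) (a b c : R).
Local Open Scope classical_set_scope.

Local Notation lebesgue := (@lebesgue_measure R).
Local Notation int a b f := (Rintegral lebesgue `[a, b[ f).

Lemma bounded_monotone_integrable f B (i : interval R) :
  nondecreasing_fun f -> (forall x, `|f x| <= B) ->
  (lebesgue [set` i] < +oo)%E -> lebesgue.-integrable [set` i] (EFin \o f).
Proof.
move=> fm fB fin; apply: measurable_bounded_integrable => //.
  exact: nondecreasing_measurable.
exists B; split; first exact: num_real.
by move=> M BM x _ /=; apply: le_trans (fB x) (ltW BM).
Qed.

Lemma itv_finite a b : (lebesgue `[a, b[%classic < +oo)%E.
Proof. by rewrite lebesgue_measure_itv /=; case: ifP => _; rewrite ?ltry // -EFinB ltry. Qed.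

Lemma int_cst a b (r : R) : a <= b -> int a b (fun=> r) = r * (b - a).
Proof.
move=> ab; rewrite Rintegral_cst //= lebesgue_measure_itv /= lte_fin.
by move: ab; rewrite le_eqVlt => /orP[/eqP->|ab]; rewrite ?ltxx ?subrr // ab.
Qed.

Lemma int_split f a b c : a <= b -> b <= c ->
  lebesgue.-integrable `[a, c[ (EFin \o f) -> int a c f = int a b f + int b c f.
Proof.
move=> ab bc fi; have e : `[a, c[%classic = `[a, b[ `|` `[b, c[ by apply: itv_bndbnd_setU; rewrite bnd_simp.
rewrite [in LHS]e Rintegral_setU //=; first by rewrite -e.
apply/disj_setPS => y [/=]; rewrite 2!in_itv/= => /andP[_ yx] /andP[].
by rewrite leNgt yx.
Qed.

Section Riemann.
Variables (f : R -> R) (B : R) (n : nat).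
Hypotheses (fm : nondecreasing_fun f) (fB : forall x, `|f x| <= B).
Let h : R := n.+1%:R^-1.
Let p i : R := i%:R * h.

Definition riemann_sum (g : R -> R) := h * \sum_(i < n.+1) g (i%:R * h).

Let h0 : 0 < h. Proof. by rewrite invr_gt0 ltr0n. Qed.

Let p_le i j : (i <= j)%N -> p i <= p j.
Proof. by move=> ij; rewrite ler_pM2r // ler_nat. Qed.

Let fi a b : lebesgue.-integrable `[a, b[ (EFin \o f).
Proof. exact: bounded_monotone_integrable fm fB (itv_finite a b). Qed.

Let step i : h * f (p i) <= int (p i) (p i.+1) f <= h * f (p i.+1).
Proof.
have pS : p i.+1 - p i = h by rewrite /p -mulrBl -natrB // subSnn mul1r.
have ci (r : R) : lebesgue.-integrable `[p i, p i.+1[ (EFin \o (fun=> r : R)).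
  apply: (@bounded_monotone_integrable _ `|r|) => //; exact: itv_finite.
have pp : p i <= p i.+1 by apply: p_le.
rewrite -pS ![(p i.+1 - p i) * _]mulrC -!int_cst //; apply/andP; split.
  by apply: le_Rintegral => // x /=; rewrite in_itv /= => /andP[h1 _]; apply: fm.
by apply: le_Rintegral => // x /=; rewrite in_itv /= => /andP[_ h1]; apply/fm/ltW.
Qed.

Let sums m : h * \sum_(i < m) f (p i) <= int 0 (p m) f <= h * \sum_(i < m) f (p i.+1).
Proof.
elim: m => [|m /andP[IH1 IH2]].
  by rewrite !big_ord0 mulr0 /p mul0r set_itv_ge ?bnd_simp ?ltxx // Rintegral_set0 lexx.
have /andP[s1 s2] := step m.
rewrite !big_ord_recr /= !mulrDr (@int_split _ _ (p m)) //.
- by rewrite !lerD.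
- by rewrite mulr_ge0 // ltW.
- exact: p_le.
Qed.

(** The integral lies between the left and the right Riemann sum, whose difference telescopes to
    [h * (f 1 - f 0)]. Only [B] and [n] enter the bound. *)
Lemma riemann_bound : `|int 0 1 f - riemann_sum f| <= 2 * B / n.+1%:R.
Proof.
have p1 : p n.+1 = 1 by rewrite /p mulfV // pnatr_eq0.
have := sums n.+1; rewrite p1 => /andP[s1 s2].
have tele : \sum_(i < n.+1) f (p i.+1) = \sum_(i < n.+1) f (p i) - f (p 0%N) + f 1.
  by rewrite big_ord_recr [in RHS]big_ord_recl /= p1; ring.
move: s2; rewrite tele => s2.
have fb x : - B <= f x <= B by rewrite -ler_norml.
have /andP[_ b1] := fb 1; have /andP[b2 _] := fb (p 0%N).
have d : h * (f 1 - f (p 0%N)) <= 2 * B / n.+1%:R.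
  by rewrite -/h mulrC ler_pM2r //; lra.
rewrite /riemann_sum -/p ger0_norm ?subr_ge0 //.
set S := \sum_(i < n.+1) _ in s1 s2 *.
apply: le_trans d; move: s2; rewrite -/(p _); lra.
Qed.

End Riemann.

(** Compactness gives a cluster point, and an ultrafilter converges to each of its cluster
    points. *)
Lemma ultra_bounded_cvg (U : set_system nat) (u : nat -> R) B : UltraFilter U ->
  (forall N, 0 <= u N <= B) -> exists l : R, u @ U --> l.
Proof.
move=> UU ub.
have PU : ProperFilter (u @ U) by apply: fmap_proper_filter.
have UA : (u @ U) `[0, B]%classic.
  suff : U (u @^-1` `[0, B]) by [].
  by apply: filterE => N /=; rewrite in_itv /=; apply: ub.
have [l [_ cl]] := segment_compact PU UA.
exists l => A Al.
have [//|Un] := in_ultra_setVsetC (u @^-1` A) UU.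
have [x [nx Ax]] := cl (~` A) A Un Al.
by case: nx.
Qed.

Lemma cvg_exp (U : set_system nat) (u : nat -> R) (l : R) k : ProperFilter U ->
  u @ U --> l -> (fun N => u N ^+ k) @ U --> l ^+ k.
Proof.
move=> PU ul; elim: k => [|k IH].
  by rewrite expr0; under eq_fun => N do rewrite expr0; apply: cvg_cst.
by rewrite exprS; under eq_fun => N do rewrite exprS; apply: cvgM.
Qed.

Lemma cvg_ord_sum (U : set_system nat) n (u : 'I_n -> nat -> R) (l : 'I_n -> R) : ProperFilter U ->
  (forall i, u i @ U --> l i) -> (fun N => \sum_(i < n) u i N) @ U --> \sum_(i < n) l i.
Proof.
move=> PU; elim: n u l => [|n IH] u l ul.
  by rewrite big_ord0; under eq_fun => N do rewrite big_ord0; apply: cvg_cst.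
rewrite big_ord_recr /=; under eq_fun => N do rewrite big_ord_recr /=.
by apply: cvgD => //; apply: IH.
Qed.

(* Riemann sums of monotone functions converge uniformly, so that integrals pass
   to the pointwise limit along an ultrafilter. *)
Lemma monotone_moment_limit (Q : nat -> R -> R) (M : nat -> R) B :
  (forall N, nondecreasing_fun (Q N)) -> (forall N x, 0 <= Q N x <= B) ->
  (forall k N, (k <= N)%N -> int 0 1 (fun u => Q N u ^+ k) = M k) ->
  exists q : R -> R, [/\ nondecreasing_fun q, forall x, 0 <= q x <= B &
    forall k, int 0 1 (fun u => q u ^+ k) = M k].
Proof.
move=> Qm QB QM.
(* [U] refines the neighbourhoods of infinity, so whatever holds for all large [N] passes to the
   limit. *)
have [U [UU sU]] := @ultraFilterLemma nat (\oo)%classic _.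
have PU : ProperFilter U by exact: ultra_proper.
have /choice[q qcvg] : forall x, exists l : R, (fun N => Q N x) @ U --> l.
  by move=> x; apply: (ultra_bounded_cvg UU (B := B)).
have qm : nondecreasing_fun q.
  move=> x y xy; apply: (ler_cvg_to (qcvg x) (qcvg y)).
  by apply: filterE => N; apply: Qm.
have qB x : 0 <= q x <= B.
  apply/andP; split.
    by apply: (cvgr_to_ge (qcvg x)); apply: filterE => N; have /andP[] := QB N x.
  by apply: (cvgr_to_le (qcvg x)); apply: filterE => N; have /andP[] := QB N x.
exists q; split=> // k.
have B0 : 0 <= B by have /andP[] := QB 0%N 0; apply: le_trans.
have expm (g : R -> R) : nondecreasing_fun g -> (forall x, 0 <= g x <= B) ->
    nondecreasing_fun (fun u => g u ^+ k) /\ forall x, `|g x ^+ k| <= B ^+ k.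
  move=> gm gB; split=> [x y xy|x].
    by have /andP[gx _] := gB x; have /andP[gy _] := gB y; rewrite lerXn2r ?nnegrE ?gm.
  have /andP[gx gxB] := gB x.
  by rewrite ger0_norm ?exprn_ge0 // lerXn2r ?nnegrE.
(* Two errors of [riemann_bound] add up: that of [q ^ k], and that of [Q N ^ k], whose integral is
   exactly [M k] once [k <= N]. For fixed [n] the Riemann sums are finite and converge. *)
have close n : `|int 0 1 (fun u => q u ^+ k) - M k| <= 4 * B ^+ k / n.+1%:R.
  have [m1 b1] := expm q qm qB.
  have r1 := riemann_bound n m1 b1.
  set S := riemann_sum n _ in r1.
  have Scvg : (fun N => riemann_sum n (fun u => Q N u ^+ k)) @ U --> S.
    by apply: cvgMl_tmp; apply: cvg_ord_sum => i; apply: cvg_exp.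
  have near : \forall N \near U, `|M k - riemann_sum n (fun u => Q N u ^+ k)| <= 2 * B ^+ k / n.+1%:R.
    apply: sU; exists k => // N /= kN; rewrite -(QM k N kN).
    by have [m2 b2] := expm _ (Qm N) (QB N); apply: riemann_bound.
  have r2 : `|M k - S| <= 2 * B ^+ k / n.+1%:R.
    apply: (cvgr_to_le _ near); apply: cvg_norm; apply: cvgB => //; exact: cvg_cst.
  have -> : int 0 1 (fun u => q u ^+ k) - M k =
     (int 0 1 (fun u => q u ^+ k) - S) - (M k - S) by ring.
  apply: le_trans (ler_normB _ _) _; apply: le_trans (lerD r1 r2) _.
  rewrite -mulrDl (_ : 4 * B ^+ k = 2 * B ^+ k + 2 * B ^+ k) //; ring.
apply/eqP; rewrite -subr_eq0 -normr_le0 leNgt; apply/negP => d0.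
set d := `|_| in close d0.
have [n nd] : exists n : nat, 4 * B ^+ k / d < n%:R.
  by exists (Num.truncn (4 * B ^+ k / d)).+1; rewrite truncnS_gt.
have := close n; rewrite leNgt => /negP[].
rewrite ltr_pdivrMr ?ltr0n // [d * _]mulrC -ltr_pdivrMr //.
by apply: lt_trans nd _; rewrite ltr_nat.
Qed.

End MonotoneIntegrals.

(** * Favard's theorem for bounded parameters *)

Section Favard.
Variable R : realType.
Local Open Scope classical_set_scope.
Local Notation lebesgue := (@lebesgue_measure R).
Local Notation int a b f := (Rintegral lebesgue `[a, b[ f).

(* The step function equal to [y0] before [u0] and then, for the successive pairs
   [(w, y)] of [l], to [y] on an interval of length [w]. *)
Fixpoint step_fun (y0 : R) (l : seq (R * R)) (u0 u : R) : R :=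
  if l is (w, y) :: l' then
    if u < u0 then y0 else step_fun y l' (u0 + w) u
  else y0.

Let sorted_from (y0 : R) (l : seq (R * R)) := path <=%R y0 (unzip2 l).

Lemma step_fun_ge y0 l u0 u : sorted_from y0 l -> y0 <= step_fun y0 l u0 u.
Proof.
elim: l y0 u0 => [|[w y] l IH] y0 u0 //= /andP[y0y yl].
by case: ifP => // _; apply: le_trans y0y (IH _ _ yl).
Qed.

Lemma step_fun_le B y0 l u0 u : y0 <= B -> (forall p, p \in l -> p.2 <= B) ->
  step_fun y0 l u0 u <= B.
Proof.
elim: l y0 u0 => [|[w y] l IH] y0 u0 //= y0B h.
case: ifP => // _; apply: IH; first by apply: (h (w, y)); rewrite mem_head.
by move=> p pl; apply: h; rewrite in_cons pl orbT.
Qed.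

Lemma step_fun_monotone y0 l u0 : sorted_from y0 l -> nondecreasing_fun (step_fun y0 l u0).
Proof.
elim: l y0 u0 => [|[w y] l IH] y0 u0; first by move=> _ u v _ /=.
move=> /= /andP[y0y yl] u v uv.
case: ifP => uu0; case: ifP => vu0 //.
- by apply: le_trans y0y (step_fun_ge _ _ yl).
- by move: (le_lt_trans uv vu0); rewrite uu0.
- exact: IH.
Qed.

(** The left end [a] may lie before [u0], so that the induction hypothesis covers the interval from
    [u0] to [u0 + w], on which the next value [y] is taken. *)
Lemma int_step_fun y0 l a u0 k : 0 <= y0 -> a <= u0 -> (forall p, p \in l -> 0 <= p.1) ->
  sorted_from y0 l ->
  int a (u0 + \sum_(p <- l) p.1) (fun u => step_fun y0 l u0 u ^+ k) =
  y0 ^+ k * (u0 - a) + \sum_(p <- l) p.1 * p.2 ^+ k.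
Proof.
elim: l y0 u0 a => [|[w y] l IH] y0 u0 a y00 au0 wl sl.
  by rewrite !big_nil !addr0 /= int_cst.
rewrite !big_cons /=; move: (sl) => /= /andP[y0y yl].
have w0 : 0 <= w := wl (w, y) (mem_head _ _).
have wl' p : p \in l -> 0 <= p.1 by move=> pl; apply: wl; rewrite in_cons pl orbT.
have s0 : 0 <= \sum_(p <- l) p.1.
  by rewrite big_seq; apply: sumr_ge0 => p /wl'.
rewrite (@int_split _ _ _ u0) //; last 2 first.
- by rewrite lerDl addr_ge0.
- have [B hB] : exists B, forall p, p \in (w, y) :: l -> p.2 <= B.
    elim: ((w, y) :: l) => [|p s [B hB]]; first by exists 0.
    exists (Num.max p.2 B) => p'; rewrite in_cons le_max => /orP[/eqP->|/hB->].
      by rewrite lexx.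
    by rewrite orbT.
  have sB u : 0 <= step_fun y0 ((w, y) :: l) u0 u <= Num.max y0 B.
    apply/andP; split; first exact: le_trans y00 (step_fun_ge _ _ sl).
    apply: step_fun_le => [|p /hB h]; first by rewrite le_max lexx.
    by rewrite le_max h orbT.
  apply: (@bounded_monotone_integrable _ _ (Num.max y0 B ^+ k)); last exact: itv_finite.
  + move=> u v uv; have /andP[h1 _] := sB u; have /andP[h2 _] := sB v.
    by rewrite lerXn2r ?nnegrE //; apply: (step_fun_monotone _ sl).
  + move=> u; have /andP[h1 h2] := sB u.
    by rewrite ger0_norm ?exprn_ge0 // lerXn2r ?nnegrE // (le_trans h1 h2).
congr (_ + _).
  rewrite -int_cst //; apply: eq_Rintegral => u.
  by rewrite inE /= in_itv /= => /andP[_ ->].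
have u0w : u0 <= u0 + w by rewrite lerDl.
have e : u0 + w - u0 = w by ring.
rewrite addrA; have := IH y (u0 + w) u0 (le_trans y00 y0y) u0w wl' yl.
rewrite e [y ^+ k * w]mulrC => <-.
apply: eq_Rintegral => u; rewrite inE /= in_itv /= => /andP[uu _].
by rewrite ltNge uu.
Qed.

Lemma transport (P : prob_on_line R) (f : measurableTypeR R -> measurableTypeR R) :
  measurable_fun setT f ->
  (forall k, P.-integrable setT (fun x => (f x ^+ k)%:E)) ->
  exists nu : prob_on_line R, finite_moments nu /\
    forall k, moment nu k = Rintegral P setT (fun x => f x ^+ k).
Proof.
move=> mf fint.
pose X : {mfun measurableTypeR R >-> measurableTypeR R} :=
  MeasurableFun.Pack (MeasurableFun.Class (isMeasurableFun.Build _ _ _ _ _ mf)).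
pose nu : prob_on_line R := distribution P X.
have mX k : measurable_fun setT (fun x : measurableTypeR R => (x ^+ k)%:E).
  by apply/measurable_EFinP.
exists nu; split=> k.
  exact: (integrable_pushforward mf (mX k) (fint k) measurableT).
by rewrite /moment /Rintegral (integral_pushforward mf (mX k) (fint k) measurableT).
Qed.

(** The measure is the law of [q] under the uniform distribution; [q] acts as a quantile
    function. *)
Lemma uniform_moments (q : R -> R) B : nondecreasing_fun q -> (forall x, 0 <= q x <= B) ->
  exists nu : prob_on_line R, finite_moments nu /\
    forall k, moment nu k = int 0 1 (fun u => q u ^+ k).
Proof.
move=> qm qB.
pose P : prob_on_line R := uniform_prob (@ltr01 R).
have mq : measurable_fun setT (q : measurableTypeR R -> measurableTypeR R).
  exact: nondecreasing_measurable.
have B0 : 0 <= B by have /andP[] := qB 0; apply: le_trans.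
have q0 k x : 0 <= q x ^+ k by rewrite exprn_ge0 //; have /andP[] := qB x.
have qb k x : `|q x ^+ k| <= B ^+ k.
  by have /andP[h1 h2] := qB x; rewrite ger0_norm // lerXn2r ?nnegrE.
have qkm k : nondecreasing_fun (fun x => q x ^+ k).
  move=> x y xy; have /andP[h1 _] := qB x; have /andP[h2 _] := qB y.
  by rewrite lerXn2r ?nnegrE ?qm.
have [|nu [nufin nuE]] := @transport P q mq.
  move=> k; apply: (@measurable_bounded_integrable _ _ _ P (fun x => q x ^+ k)) => //.
  - exact: le_lt_trans (probability_le1 P measurableT) (ltry 1).
  - exact: measurable_funX.
  - exists (B ^+ k); split; first exact: num_real.
    by move=> M BM x _ /=; apply: le_trans (qb k x) (ltW BM).
exists nu; split=> // k; rewrite nuE.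
have li : lebesgue.-integrable `[0, 1[ (EFin \o (fun u => q u ^+ k)).
  exact: (bounded_monotone_integrable (qkm k) (qb k) (itv_finite 0 1)).
rewrite [RHS]Rintegral_itv_bndo_bndc //.
rewrite /Rintegral (@integral_uniform _ _ _ ltr01) //; last 2 first.
- by apply/measurable_EFinP; apply: measurable_funX.
- by move=> x; rewrite lee_fin.
by rewrite subr0 invr1 mul1e.
Qed.

(** All quadrature nodes lie between [- L] and [L] with [L = 3 * B], the bound of
    [tridiag_eigen_bound]. They are shifted by [L] to become nonnegative, because then every power
    of a quantile function is monotone as well; the shift is undone at the end. *)
Theorem favard (beta gamma : nat -> R) B : (forall i, 0 <= gamma i) ->
  (forall i, `|beta i| <= B) -> (forall i, Num.sqrt (gamma i) <= B) ->
  exists mu : prob_on_line R, finite_moments mu /\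
    forall k, moment mu k = jmom beta gamma k.
Proof.
move=> g0 bB gB; pose L := 3 * B.
(* Pairs of a weight and a shifted node, sorted by node to make the step function monotone.
   Exactness is stated at the unshifted nodes [a.2 - L]. *)
have quad N : exists l : seq (R * R), [/\ forall p, p \in l -> 0 <= p.1,
    forall p, p \in l -> 0 <= p.2 <= 2 * L, sorted_from 0 l &
    forall p : {poly R}, (size p <= N.+1)%N ->
      \sum_(a <- l) a.1 * p.[a.2 - L] = \sum_(j < N.+1) p`_j * jmom beta gamma j].
  have [w [x [w0 xL mom]]] := jacobi_quadrature N g0 bB gB.
  pose l0 := [seq (w i, L + x i) | i <- enum 'I_N.+1].
  pose l := sort (fun a b : R * R => a.2 <= b.2) l0.
  have ml a : a \in l -> exists i, a = (w i, L + x i).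
    by rewrite mem_sort => /mapP[i _ ->]; exists i.
  have lL a : a \in l -> 0 <= a.2 <= 2 * L.
    by move=> /ml[i ->] /=; have := xL i; rewrite ler_norml -/L => /andP[] ? ?; lra.
  exists l; split=> //.
  - by move=> a /ml[i ->]; apply: w0.
  - rewrite /sorted_from path_min_sorted.
      rewrite sorted_map; apply: sort_sorted => a b; exact: le_total.
    by apply/allP => y /mapP[a /lL/andP[h _] ->].
  - move=> p pN; rewrite (perm_big l0) /=; last by rewrite perm_sort.
    rewrite big_map big_enum /=.
    under eq_bigr => i _ do rewrite addrAC subrr add0r (horner_coef_wide _ pN) mulr_sumr.
    rewrite exchange_big /=; apply: eq_bigr => j _.
    rewrite -mom; last by rewrite -ltnS.
    by rewrite mulr_sumr; apply: eq_bigr => i _; rewrite mulrCA.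
have /choice[l lP] := quad.
pose Q N := step_fun 0 (l N) 0.
have Qm N : nondecreasing_fun (Q N) by have [_ _ h _] := lP N; apply: step_fun_monotone.
have L0 : 0 <= 2 * L.
  have := le_trans (normr_ge0 _) (bB 0%N); rewrite /L; lra.
have QB N u : 0 <= Q N u <= 2 * L.
  have [_ h2 h3 _] := lP N; rewrite step_fun_ge //=.
  by apply: step_fun_le => // p /h2/andP[].
have sumw N : \sum_(a <- l N) a.1 = 1.
  have [_ _ _ h] := lP N; have := h 1; rewrite size_poly1 => /(_ isT).
  under eq_bigr => a _ do rewrite hornerC mulr1.
  move=> ->; rewrite big_ord_recl coefC /= mul1r big1 ?addr0 // => i _.
  by rewrite coefC mul0r.
have Qmom N k : int 0 1 (fun u => Q N u ^+ k) = \sum_(a <- l N) a.1 * a.2 ^+ k.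
  have [h1 _ h3 _] := lP N.
  by have := int_step_fun k (lexx 0) (lexx 0) h1 h3; rewrite subrr mulr0 !add0r sumw.
have QM k N : (k <= N)%N -> int 0 1 (fun u => Q N u ^+ k) =
    \sum_(j < k.+1) (('X + L%:P) ^+ k)`_j * jmom beta gamma j.
  move=> kN; rewrite Qmom; have [_ _ _ h] := lP N.
  have sz : size (('X + L%:P) ^+ k) = k.+1.
    by rewrite -(opprK L) polyCN size_exp_XsubC.
  have := h (('X + L%:P) ^+ k); rewrite sz ltnS => /(_ kN).
  under eq_bigr => a _ do rewrite horner_exp hornerD hornerX hornerC subrK.
  move=> ->; rewrite [RHS](big_ord_widen N.+1 (fun j => (('X + L%:P) ^+ k)`_j * jmom beta gamma j)) //.
  rewrite [RHS]big_mkcond /=; apply: eq_bigr => j _; case: ifP => // /negbT.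
  by rewrite -leqNgt -sz => /(nth_default 0)->; rewrite mul0r.
have [q [qm qB qM]] := monotone_moment_limit Qm QB QM.
have [nu [nufin nuM]] := uniform_moments qm qB.
have nuE k N : (k <= N)%N -> moment nu k = \sum_(a <- l N) a.1 * a.2 ^+ k.
  by move=> kN; rewrite nuM qM -(QM k N kN) Qmom.
have mf : measurable_fun setT ((fun x => x - L) : measurableTypeR R -> measurableTypeR R).
  by apply: measurable_funB.
have pE k (x : R) : (x - L) ^+ k = (('X - L%:P) ^+ k).[x].
  by rewrite horner_exp hornerD hornerN hornerX hornerC.
have [k|mu [mufin muE]] := @transport nu _ mf.
  have := integrable_poly nufin (('X - L%:P) ^+ k); congr (integrable _ _ _).
  by apply: funext => x /=; rewrite pE.
exists mu; split=> // k; rewrite muE.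
transitivity (expect nu (('X - L%:P) ^+ k)).
  by apply: eq_Rintegral => x _; rewrite pE.
have sz : size (('X - L%:P) ^+ k) = k.+1 by rewrite size_exp_XsubC.
rewrite (@expect_coef _ _ nufin _ k.+1) ?sz //.
(* Up to order [k] the moments of [nu] are those of the shifted quadrature [l k], so the two shifts
   cancel and the exactness of [l k] on ['X^k] applies. *)
transitivity (\sum_(a <- l k) a.1 * (('X : {poly R}) ^+ k).[a.2 - L]).
  under [RHS]eq_bigr => a _ do rewrite hornerXn pE (horner_coef_wide (n := k.+1)) ?sz // mulr_sumr.
  rewrite exchange_big /=; apply: eq_bigr => i _.
  rewrite (nuE i k (ltn_ord i)) mulr_sumr; apply: eq_bigr => a _; rewrite mulrCA //.
have [_ _ _ ->] := lP k; last by rewrite size_polyXn.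
rewrite (bigD1 ord_max) //= coefXn eqxx mul1r big1 ?addr0 // => i.
by rewrite -val_eqE /= coefXn => /negPf->; rewrite mul0r.
Qed.

End Favard.

(** * Conditionally free powers *)

Section Powers.
Variable R : realType.
Implicit Types (mu mut : prob_on_line R) (r Rc : nat -> R) (T TR : pser R).

Definition mom mu : pser R := moment mu.

Lemma free_cumulants_eq mu r :
  is_free_cumulants mu r -> cfree_eq (pshift (r : pser R)) (mom mu) (mom mu).
Proof.
move=> h; have -> : mom mu = cfree_seq r r.
  by apply: pserP => m; rewrite /mom h nc_seqE.
exact: cfree_seq_eq.
Qed.

Lemma cfree_cumulants_eq mut mu r Rc : is_free_cumulants mu r ->
  is_cfree_cumulants mut r Rc -> cfree_eq (pshift (Rc : pser R)) (mom mu) (mom mut).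
Proof.
move=> h h'; have -> : mom mu = cfree_seq r r.
  by apply: pserP => m; rewrite /mom h nc_seqE.
have -> : mom mut = cfree_seq r Rc.
  by apply: pserP => m; rewrite /mom h' cfree_seqE.
exact: cfree_seq_eq.
Qed.

Lemma eq_free_cumulants mu r :
  cfree_eq (pshift (r : pser R)) (mom mu) (mom mu) -> is_free_cumulants mu r.
Proof.
move=> h m; rewrite -nc_seqE -[moment mu]/(mom mu).
by rewrite (free_eq_uniq h (@cfree_seq_eq R r r)).
Qed.

Lemma eq_cfree_cumulants mut mu r Rc : is_free_cumulants mu r ->
  cfree_eq (pshift (Rc : pser R)) (mom mu) (mom mut) -> is_cfree_cumulants mut r Rc.
Proof.
move=> hr h m; rewrite -cfree_seqE -[moment mut]/(mom mut).
have e : mom mu = cfree_seq r r by apply: pserP => k; rewrite /mom hr nc_seqE.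
by rewrite e in h; rewrite (cfree_eq_uniq h (@cfree_seq_eq R r Rc)).
Qed.

Lemma pshift_scale (t : R) r : pshift ((fun n => t * r n) : pser R) = pC t * pshift (r : pser R).
Proof. by apply: pserP => n; rewrite pserCM. Qed.

(** The free cumulants of [mu] and [mu_t] are chosen twice in the definition. This does no harm, as
    the last equation involves [mu_t] only through its moments. *)
Lemma cfree_power_series mut mu t mut_t mu_t : is_cfree_power mut mu t mut_t mu_t ->
  exists T TR, [/\ cfree_eq T (mom mu) (mom mu), cfree_eq TR (mom mu) (mom mut),
    cfree_eq (pC t * T) (mom mu_t) (mom mu_t) & cfree_eq (pC t * TR) (mom mu_t) (mom mut_t)].
Proof.
case=> [[_ [r0 [h0 h0t]]] _ [r [r_t [Rc [h ht hc hct]]]]].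
exists (pshift (r0 : pser R)), (pshift (Rc : pser R)); split.
- exact: free_cumulants_eq.
- exact: cfree_cumulants_eq h hc.
- by rewrite -pshift_scale; apply: free_cumulants_eq.
- by rewrite -pshift_scale; apply: cfree_cumulants_eq ht hct.
Qed.

Lemma series_cfree_power mut mu (t : R) mut_t mu_t T TR :
  finite_moments mut_t -> finite_moments mu_t ->
  cfree_eq T (mom mu) (mom mu) -> cfree_eq TR (mom mu) (mom mut) ->
  cfree_eq (pC t * T) (mom mu_t) (mom mu_t) -> cfree_eq (pC t * TR) (mom mu_t) (mom mut_t) ->
  is_cfree_power mut mu t mut_t mu_t.
Proof.
move=> fin_t fin h hc ht hct.
(* The value at index 0 is arbitrary and is discarded by [pshift]. *)
pose r n := T n.-1; pose Rc n := TR n.-1.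
have rT : pshift (r : pser R) = T by apply: pserP.
have RT : pshift (Rc : pser R) = TR by apply: pserP.
have Hr : is_free_cumulants mu r by apply: eq_free_cumulants; rewrite rT.
have Hrt : is_free_cumulants mu_t (fun n => t * r n).
  by apply: eq_free_cumulants; rewrite pshift_scale rT.
split=> //; first by split=> //; exists r.
exists r, (fun n => t * r n), Rc; split=> //.
  by apply: eq_cfree_cumulants Hr _; rewrite RT.
by apply: eq_cfree_cumulants Hrt _; rewrite pshift_scale RT.
Qed.

Lemma mom0 mu : mom mu 0%N = 1. Proof. exact: moment0. Qed.

Lemma favard_row3 (a b c x y z : R) : 0 <= x -> 0 <= y -> 0 <= z ->
  exists mu, finite_moments mu /\ mom mu = jmom (row3 a b c) (row3 x y z).
Proof.
move=> x0 y0 z0.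
pose B := `|a| + `|b| + `|c| + Num.sqrt x + Num.sqrt y + Num.sqrt z.
have := (normr_ge0 a, normr_ge0 b, normr_ge0 c).
have := (sqrtr_ge0 x, sqrtr_ge0 y, sqrtr_ge0 z) => -[[sx sy] sz] [[na nb] nc].
have [|||mu [fin e]] := @favard R (row3 a b c) (row3 x y z) B.
- by case=> [|[|i]].
- by case=> [|[|i]] /=; rewrite /B; lra.
- by case=> [|[|i]] /=; rewrite /B; lra.
by exists mu; split=> //; apply: pserP.
Qed.

Lemma row2E (a b : R) : row2 a b = row3 a b b.
Proof. by apply: funext => -[|[|m]]. Qed.

End Powers.

Theorem theorem5p1 (R : realType) (mut mu : prob_on_line R)
    (betat gammat beta gamma : nat -> R)
    (mut_moments : finite_moments mut) (mu_moments : finite_moments mu)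
    (mut_jacobi : is_jacobi mut betat gammat)
    (mu_jacobi : is_jacobi mu beta gamma)
    (mut_nondeg : ~ point_mass mut) (mu_nondeg : ~ point_mass mu) :
  ((exists B C : nat -> {poly R},
      forall t : nat, (0 < t)%N ->
        exists mut_t mu_t : prob_on_line R,
          is_cfree_power mut mu t%:R mut_t mu_t /\
          is_jacobi mut_t (fun m => (B m).[t%:R]) (fun m => (C m).[t%:R])) ->
    jacobi_coincide betat gammat beta gamma)
  /\
  (jacobi_coincide betat gammat beta gamma ->
    let bt := betat 1%N - beta 0%N in
    let b := beta 1%N - beta 0%N in
    let ct := gammat 1%N - gamma 0%N in
    let c := gamma 1%N - gamma 0%N in
    [/\ forall t : R, 0 <= t -> 0 <= c + gamma 0%N * t ->
          0 <= ct + gamma 0%N * t ->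
          (exists mut_t mu_t : prob_on_line R,
             is_cfree_power mut mu t mut_t mu_t) /\
          (forall mut_t mu_t : prob_on_line R,
             is_cfree_power mut mu t mut_t mu_t ->
             is_jacobi mut_t
               (row3 (betat 0%N * t) (bt + beta 0%N * t) (b + beta 0%N * t))
               (row3 (gammat 0%N * t) (ct + gamma 0%N * t)
                     (c + gamma 0%N * t)) /\
             is_jacobi mu_t
               (row2 (beta 0%N * t) (b + beta 0%N * t))
               (row2 (gamma 0%N * t) (c + gamma 0%N * t))),
        cfree_infdiv mut mu <-> 0 <= c /\ 0 <= ct
      & cfree_infdiv mut mu ->
          (exists rhot : prob_on_line R,
             finite_moments rhot /\
             is_jacobi rhot (row2 bt b) (row2 ct c)) /\
          (forall (rhot : prob_on_line R) (r Rc : nat -> R),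
             finite_moments rhot ->
             is_jacobi rhot (row2 bt b) (row2 ct c) ->
             is_free_cumulants mu r -> is_cfree_cumulants mut r Rc ->
             forall k : nat,
               cfree_R_transform Rc k =
               betat 0%N * fps_mulXn 1 (fps_C 1) k +
               gammat 0%N * fps_mulXn 2 (fps_integral rhot (@fps_geom R)) k)]).
Proof.
(* The variance is nonnegative as a squared norm and vanishes only for a point mass. *)
have gamma_gt0 nu (be ga : nat -> R) : finite_moments nu -> is_jacobi nu be ga ->
    ~ point_mass nu -> 0 < ga 0%N.
  move=> fin J npm; rewrite lt_neqAle eq_sym; apply/andP; split.
    by apply/eqP => /(point_mass_gamma0 fin J).
  by have := prod_gamma_ge0 fin 1 J; rewrite big_ord1.
have g0 := gamma_gt0 _ _ _ mu_moments mu_jacobi mu_nondeg.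
have gt0 := gamma_gt0 _ _ _ mut_moments mut_jacobi mut_nondeg.
have muE : mom mu = jmom beta gamma.
  by apply: pserP => k; apply: (is_jacobi_jmom mu_moments _ _).1.
have mutE : mom mut = jmom betat gammat.
  by apply: pserP => k; apply: (is_jacobi_jmom mut_moments _ _).1.
split.
  move=> [B [C power]].
  (* The power with [t = 1] only supplies cumulant series of the pair; [cfree_eq_inj] carries them
     over to every other [t]. *)
  have [mut1 [mu1 [/cfree_power_series[T [TR [h hc _ _]]] _]]] := power 1%N isT.
  have powers (t : nat) : (0 < t)%N -> exists s : pser R,
      cfree_eq (pC t%:R * T) s s /\
      cfree_eq (pC t%:R * TR) s (jmom (fun m => (B m).[t%:R]) (fun m => (C m).[t%:R])).
    move=> t0; have [mut_t [mu_t [pw J]]] := power t t0.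
    have [T' [TR' [h' hc' ht hct]]] := cfree_power_series pw.
    exists (mom mu_t).
    rewrite (cfree_eq_inj (mom0 mu) h h') (cfree_eq_inj (mom0 mu) hc hc'); split=> //.
    have [_ fin _] := pw.
    suff <- : mom mut_t = jmom (fun m => (B m).[t%:R]) (fun m => (C m).[t%:R]) by [].
    by apply: pserP => k; apply: (is_jacobi_jmom fin _ _).1.
  rewrite muE in h hc; rewrite mutE in hc.
  have [e e1] := polynomial_powers_rigid (lt0r_neq0 gt0) (lt0r_neq0 g0) h hc powers.
  exact: coincide_of_jmom e e1.
move=> coin bt b ct c.
pose T := meixner_T (beta 0%N) (gamma 0%N) b c.
pose TR := meixner_TR (betat 0%N) (gammat 0%N) bt ct b c.
pose s t := meixner_s (beta 0%N) (gamma 0%N) b c t.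
pose st t := meixner_st (beta 0%N) (gamma 0%N) (betat 0%N) (gammat 0%N) bt ct b c t.
(* At [t = 1] the Meixner parameters equal the given ones wherever these are defined, and [jmom_ext]
   disposes of the others. *)
have sE : mom mu = s 1.
  rewrite muE; apply: jmom_ext => -[|m] def /=; first by rewrite !mulr1.
  by have [/(_ def)[-> ->] _] := coin m.+1 isT; rewrite /b /c !mulr1 !subrK.
have stE : mom mut = st 1.
  rewrite mutE; apply: jmom_ext => -[|[|m]] def /=; rewrite ?mulr1 /bt /ct ?subrK //.
  by have [_ /(_ def)[-> ->]] := coin m.+1 isT; rewrite /b /c ?mulr1 ?subrK.
have hT : cfree_eq T (mom mu) (mom mu).
  by have := meixner_free (beta 0%N) (gamma 0%N) b c 1; rewrite rmorph1 mul1r sE.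
have hTR : cfree_eq TR (mom mu) (mom mut).
  have := meixner_cfree (beta 0%N) (gamma 0%N) (betat 0%N) (gammat 0%N) bt ct b c 1.
  by rewrite rmorph1 mul1r sE stE.
have exist (t : R) : 0 <= t -> 0 <= c + gamma 0%N * t -> 0 <= ct + gamma 0%N * t ->
    exists mut_t mu_t : prob_on_line R, is_cfree_power mut mu t mut_t mu_t.
  move=> t0 c0 ct0.
  have gt : 0 <= gamma 0%N * t by rewrite mulr_ge0 // ltW.
  have gtt : 0 <= gammat 0%N * t by rewrite mulr_ge0 // ltW.
  have [mu_t [fin e]] := favard_row3 (beta 0%N * t) (b + beta 0%N * t) (b + beta 0%N * t) gt c0 c0.
  have [mut_t [fint et]] :=
    favard_row3 (betat 0%N * t) (bt + beta 0%N * t) (b + beta 0%N * t) gtt ct0 c0.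
  exists mut_t, mu_t; rewrite -!row2E in e.
  apply: (series_cfree_power fint fin hT hTR); rewrite e ?et.
    exact: meixner_free.
  exact: meixner_cfree.
have params (t : R) mut_t mu_t : is_cfree_power mut mu t mut_t mu_t ->
    is_jacobi mut_t
      (row3 (betat 0%N * t) (bt + beta 0%N * t) (b + beta 0%N * t))
      (row3 (gammat 0%N * t) (ct + gamma 0%N * t) (c + gamma 0%N * t)) /\
    is_jacobi mu_t (row2 (beta 0%N * t) (b + beta 0%N * t))
      (row2 (gamma 0%N * t) (c + gamma 0%N * t)).
  move=> pw; have [T' [TR' [h hc ht hct]]] := cfree_power_series pw.
  have [[fin _] fint _] := pw.
  rewrite (cfree_eq_inj (mom0 mu) h hT) in ht.
  rewrite (cfree_eq_inj (mom0 mu) hc hTR) in hct.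
  have e : mom mu_t = s t by apply: free_eq_uniq ht (meixner_free _ _ _ _ _).
  rewrite e in hct.
  have et : mom mut_t = st t by apply: cfree_eq_uniq hct (meixner_cfree _ _ _ _ _ _ _ _ _).
  split; apply/is_jacobi_jmom => // k.
    by rewrite -[moment mut_t]/(mom mut_t) et.
  by rewrite -[moment mu_t]/(mom mu_t) e.
have infdiv : cfree_infdiv mut mu <-> 0 <= c /\ 0 <= ct.
  split=> [inf|[c0 ct0] t t0]; last first.
    by apply: exist => //; rewrite addr_ge0 // mulr_ge0 // ltW.
  (* For each measure of the power, the product of the first two [gamma] parameters is a squared
     norm, and its first factor is positive. *)
  have pos (t : R) : 0 < t -> 0 <= c + gamma 0%N * t /\ 0 <= ct + gamma 0%N * t.
    move=> t0; have [mut_t [mu_t pw]] := inf t (ltW t0).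
    have [Jt J] := params _ _ _ pw; have [[fin _] fint _] := pw.
    have := prod_gamma_ge0 fin 2 J; have := prod_gamma_ge0 fint 2 Jt.
    by rewrite !big_ord_recr !big_ord0 /= !mul1r !pmulr_rge0 ?mulr_gt0.
  (* Instead of letting [t] tend to 0: a negative [x] is refuted at [t = - x / (2 * gamma 0)], where
     the expression equals [x / 2]. *)
  have lim (x : R) : (forall t, 0 < t -> 0 <= x + gamma 0%N * t) -> 0 <= x.
    move=> h; rewrite leNgt; apply/negP => x0.
    have := h (- x / (2 * gamma 0%N)); rewrite divr_gt0 ?oppr_gt0 ?mulr_gt0 // => /(_ isT).
    have -> : x + gamma 0%N * (- x / (2 * gamma 0%N)) = x / 2.
      by field; rewrite lt0r_neq0.
    by rewrite pmulr_lge0 ?invr_gt0 // leNgt x0.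
  by split; apply: lim => t /pos[].
split=> //; first by move=> t t0 c0 ct0; split; [exact: exist|exact: params].
move=> /infdiv[c0 ct0]; split.
  have [rhot [fin e]] := favard_row3 bt b b ct0 c0 c0.
  exists rhot; split=> //; apply/is_jacobi_jmom => // k.
  by rewrite -[moment rhot]/(mom rhot) e !row2E.
move=> rhot r Rc fin J hr hRc k.
have rhoE i : moment rhot i = mrho bt ct b c i by apply: (is_jacobi_jmom fin _ _).1.
(* The cumulants [Rc] are arbitrary ones of the pair; uniqueness identifies them, from order 1 on,
   with those of the Meixner family. *)
have RcE : pshift (Rc : pser R) = TR.
  exact: (cfree_eq_inj (mom0 mu) (cfree_cumulants_eq hr hRc) hTR).
case: k => [|k] /=; first by rewrite /cfree_R_transform /fps_mulXn /= !mulr0 addr0.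
have -> : cfree_R_transform Rc k.+1 = TR k by rewrite -RcE.
rewrite /TR /meixner_TR pserD pserCM pserXM /fps_mulXn subn1 /=.
case: k => [|k] /=; rewrite /fps_C /= ?mulr1 ?mulr0 ?addr0 ?add0r //.
by rewrite subSS subSS subn0 -rhoE.
Qed.
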